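(* Assume $\mathbb{E}[\phi_i^4]<\infty$ and $H\in(\frac12,\frac34)$. As $n,N\to\infty$ sequentially, the estimator $\widehat\Theta=(\widehat H,\widehat\gamma^2,\widehat\sigma^2)^\top$ of $\Theta=(H,\gamma^2,\sigma^2)^\top$ is asymptotically normal: $$\sqrt N\,(\widehat\Theta-\Theta)\xrightarrow{d}\mathcal N(0,\mathcal C),\qquad \mathcal C:=J\,\Sigma\,J^\top,$$ where $\Sigma=\mathrm{Var}(\theta_1^2)\,\mathcal H\mathcal H^\top$ with $\mathcal H=(1,h^2,h^2,4h^2)^\top$, and $J$ is the $3\times4$ Jacobian matrix of $\widehat\Theta=(\widehat H,\widehat\gamma^2,\widehat\sigma^2)^\top$ with respect to $\bar U_{n,N}=(\bar V_{n,N},\bar\xi_{n,N},\bar\eta_{n,N},\bar\zeta_{n,N})^\top$ evaluated at $U_\infty=(V_\infty,\xi_\infty,\eta_\infty,\zeta_\infty)^\top$. With $$B:=\eta_\infty-h^2V_\infty=\gamma^2h^{2H}(2^{2H-1}-1),\quad D_H:=h^{2H}(2^{2H-1}-1),\quad D'_H:=h^{2H}\big[2\ln(h)(2^{2H-1}-1)+(2\ln2)2^{2H-1}\big],$$ its rows (in the order of derivatives with respect to $V,\xi,\eta,\zeta$) have the entries: Row 1 ($\widehat H$): $\dfrac{h^2}{2\ln2}\dfrac{2^{2H}-4}{2^{2H}\gamma^2D_H}$, $\ 0$, $\ -\dfrac1{2\ln2}\dfrac1B$, $\ \dfrac1{2\ln2}\dfrac1{2^{2H}B}$. Row 2 ($\widehat\gamma^2$):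 $-\dfrac{h^2}{D_H}+\dfrac{h^2}{2\ln2}\Big(\dfrac4{2^{2H}}-1\Big)\dfrac{D'_H}{D_H^2}$, $\ 0$, $\ \dfrac1{D_H}+\dfrac{D'_H}{2\ln2}\dfrac1{D_H^2}$, $\ -\dfrac{D'_H}{2\ln2}\dfrac1{2^{2H}D_H^2}$. Row 3 ($\widehat\sigma^2$): $-h+h^{2H-1}\Big[\dfrac{h^2}{D_H}-\dfrac{h^2}{2\ln2}\Big(1-\dfrac4{2^{2H}}\Big)\Big(-\dfrac{D'_H}{D_H^2}+\dfrac{2\ln(h)}{D_H}\Big)\Big]$, $\ \dfrac1h$, $\ -h^{2H-1}\dfrac1{D_H}\Big[1-\dfrac{2\ln(h)}{2\ln2}+\dfrac{D'_H}{2\ln2}\dfrac1{D_H}\Big]$, $\ h^{2H-1}2^{-2H}\Big[\dfrac{D'_H}{2\ln2}\dfrac1{D_H^2}-\dfrac{2\ln(h)}{2\ln2}\dfrac1{D_H}\Big]$.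
   Context: Model. Fix $\sigma>0$, $\gamma>0$, a Hurst index $H$ and a time step $h>0$. For $i=1,2,\dots$ let $B^i$ be standard Brownian motions and $B^{H,i}$ fractional Brownian motions with Hurst index $H$ (centered Gaussian, covariance $\frac12(t^{2H}+s^{2H}-|t-s|^{2H})$), all mutually independent, and set $M^{H,i}_t=\sigma B^i_t+\gamma B^{H,i}_t$. The random effects $\phi_1,\phi_2,\dots$ are i.i.d. real random variables, independent of the family $\{M^{H,i}\}$. Put $\theta_i=\phi_i-\frac{\sigma^2}{2}$ and $Y^i_t=\theta_it+M^{H,i}_t$ (so $X^i_t=e^{Y^i_t}$ solves $dX^i_t=\phi_iX^i_t\,dt+X^i_t\,dM^{H,i}_t$, $X^i_0=1$). Statistics. $\Delta Y^i_k:=Y^i_{(k+1)h}-Y^i_{kh}$, $\widehat\theta_i=\frac1{nh}\sum_{k=0}^{n-1}\Delta Y^i_k$, and $\xi^i_n=\frac1n\sum_{k=0}^{n-1}(\Delta Y^i_k)^2$, $\eta^i_n=\frac1n\sum_{k=0}^{n-1}\Delta Y^i_k\Delta Y^i_{k+1}$, $\zeta^i_n=\frac1n\sum_{k=0}^{n-1}(Y^i_{(k+2)h}-Y^i_{kh})(Y^i_{(k+4)h}-Y^i_{(k+2)h})$. Averages over $N$ subjects: $\bar V_{n,N}=\frac1N\sum_{i=1}^N\widehat\theta_i^2$, $\bar\xi_{n,N}=\frac1N\sum_{i=1}^N\xi^i_n$, $\bar\eta_{n,N}=\frac1N\sum_{i=1}^N\eta^i_n$, $\bar\zeta_{n,N}=\frac1N\sum_{i=1}^N\zeta^i_n$.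 Estimators. With $\log_2^+(x):=\mathbf 1_{\{x>0\}}\log_2x$, $\widehat H=\frac12\log_2^+\!\Big(\frac{\bar\zeta_{n,N}-4h^2\bar V_{n,N}}{\bar\eta_{n,N}-h^2\bar V_{n,N}}\Big)$, $\ \widehat\gamma^2=\frac{\bar\eta_{n,N}-h^2\bar V_{n,N}}{h^{2\widehat H}(2^{2\widehat H-1}-1)}$, $\ \widehat\sigma^2=\frac{\bar\xi_{n,N}-h^2\bar V_{n,N}-\widehat\gamma^2h^{2\widehat H}}{h}$. Limit point. $V_\infty=\mathbb E[\theta_1^2]$, $\xi_\infty=\mathbb E[\theta_1^2]h^2+\sigma^2h+\gamma^2h^{2H}$, $\eta_\infty=\mathbb E[\theta_1^2]h^2+\gamma^2h^{2H}(2^{2H-1}-1)$, $\zeta_\infty=4\mathbb E[\theta_1^2]h^2+\gamma^2h^{2H}2^{2H}(2^{2H-1}-1)$. ''$n,N\to\infty$ sequentially'' means: first $n\to\infty$ with $N$ fixed, then $N\to\infty$. Normal laws may be degenerate. *)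

(* Defs.v *)
From HB Require Import structures.
From mathcomp Require Import all_boot all_order all_algebra.
From mathcomp Require Import finmap.
From mathcomp Require Import all_classical all_reals all_analysis.

Set Implicit Arguments.
Unset Strict Implicit.
Unset Printing Implicit Defensive.

Import Order.TTheory GRing.Theory Num.Theory.
Import numFieldNormedType.Exports.

Local Open Scope classical_set_scope.
Local Open Scope ring_scope.

Section independence.
Context (R : realType) (d : measure_display) (T : measurableType d)
  (P : probability T R).

Definition mutually_independent (I : choiceType) (F : I -> set (set T)) : Prop :=
  forall (J : {fset I}) (A : I -> set T),
    (forall i, i \in J -> F i (A i)) ->
    P (\bigcap_(i in [set` J]) A i) = (\prod_(i <- J) P (A i))%E.

Definition independent2 (F G : set (set T)) : Prop :=
  forall A B, F A -> G B -> P (A `&` B) = (P A * P B)%E.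

Definition sigma_family (I : Type) (D : set I) (X : I -> T -> R) :
    set (set T) :=
  <<s \bigcup_(i in D) g_sigma_algebra_preimage (X i) >>.

(* Only the times t >= 0 of a process indexed by R are meaningful. *)
Definition sigma_process (X : R -> T -> R) : set (set T) :=
  sigma_family [set t | 0 <= t] X.

Definition iid (X : nat -> T -> R) : Prop :=
  mutually_independent (fun i => g_sigma_algebra_preimage (X i)) /\
  forall i (A : set R), measurable A ->
    pushforward P (X i) A = pushforward P (X 0%N) A.

End independence.

Section gaussian.
Context (R : realType).

(* [nu] is N(m, v), where N(m, 0) is the Dirac mass at m; the case v = 0 is
   treated apart because [normal_prob m 0] is the uniform law on [0, 1]. *)
Definition is_normal (nu : set R -> \bar R) (m v : R) : Prop :=
  0 <= v /\
  forall A : set R, measurable A ->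
    nu A = if v == 0 then \d_m A else normal_prob m (Num.sqrt v) A.

Context (d : measure_display) (T : measurableType d) (P : probability T R).

Definition gaussian_process (X : R -> T -> R) : Prop :=
  forall (k : nat) (t a : 'I_k -> R), (forall i, 0 <= t i) ->
    exists m v, is_normal (pushforward P (fun w => \sum_i a i * X (t i) w)) m v.

Definition fractional_Brownian_motion (H : R) (X : R -> T -> R) : Prop :=
  [/\ gaussian_process X,
      (forall t, 0 <= t -> ('E_P[X t] = 0)%E) &
      (forall s t, 0 <= s -> 0 <= t ->
         covariance P (X s) (X t) =
         (2^-1 * (t `^ (2 * H) + s `^ (2 * H) - `|t - s| `^ (2 * H)))%:E)].

Definition standard_Brownian_motion (X : R -> T -> R) : Prop :=
  [/\ {ae P, forall w, X 0 w = 0},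
      (forall t : nat -> R, 0 <= t 0%N -> (forall i, t i <= t i.+1) ->
         mutually_independent P (fun i =>
           g_sigma_algebra_preimage (fun w => X (t i.+1) w - X (t i) w))),
      (forall s t, 0 <= s -> s <= t ->
         is_normal (pushforward P (fun w => X t w - X s w)) 0 (t - s)) &
      {ae P, forall w, {within `[0, +oo[, continuous (X ^~ w)}}].

End gaussian.

Notation borel_rV R n := (g_sigma_algebraType (@open 'rV[R]_n)).

Section random_vectors.
Context (R : realType) (n : nat).

(* N(m, C) on row vectors, possibly degenerate: every linear functional
   x |-> x *m a has law N(m a, a^T C a). *)
Definition is_mvnormal (nu : probability (borel_rV R n) R)
    (m : 'rV[R]_n) (C : 'M[R]_n) : Prop :=
  forall a : 'cV[R]_n,
    is_normal (pushforward nu (fun x : 'rV[R]_n => (x *m a) 0 0))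
      ((m *m a) 0 0) ((a^T *m C *m a) 0 0).

Definition bounded_continuous (f : 'rV[R]_n -> R) : Prop :=
  continuous f /\ exists M : R, forall x, `|f x| <= M.

Definition weak_cvg (mu : nat -> probability (borel_rV R n) R)
    (nu : probability (borel_rV R n) R) : Prop :=
  forall f : 'rV[R]_n -> R, bounded_continuous f ->
    (\int[mu k]_x (f x)%:E)%E @[k --> \oo] --> (\int[nu]_x (f x)%:E)%E.

Context (d : measure_display) (T : measurableType d) (P : probability T R).

Definition cvg_in_law (X : nat -> T -> 'rV[R]_n)
    (nu : probability (borel_rV R n) R) : Prop :=
  (forall k, measurable_fun [set: T] (X k : T -> borel_rV R n)) /\
  forall f : 'rV[R]_n -> R, bounded_continuous f ->
    ('E_P[f \o X k])%E @[k --> \oo] --> (\int[nu]_x (f x)%:E)%E.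

(* X n N converges in law as n -> oo for each fixed N >= 1, and the limit laws
   converge weakly to [nu] as N -> oo. *)
Definition sequential_cvg_in_law (X : nat -> nat -> T -> 'rV[R]_n)
    (nu : probability (borel_rV R n) R) : Prop :=
  exists mu : nat -> probability (borel_rV R n) R,
    (forall N, (0 < N)%N -> cvg_in_law (X ^~ N) (mu N)) /\ weak_cvg mu nu.

End random_vectors.

Section statistics.
Context (R : realType).

Definition row_seq (n : nat) (s : seq R) : 'rV[R]_n := \row_(j < n) s`_j.

Definition increment (h : R) (y : R -> R) (k : nat) : R :=
  y (k.+1%:R * h) - y (k%:R * h).

Definition theta_hat (h : R) (n : nat) (y : R -> R) : R :=
  (n%:R * h)^-1 * \sum_(0 <= k < n) increment h y k.

Definition xi_stat (h : R) (n : nat) (y : R -> R) : R :=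
  n%:R^-1 * \sum_(0 <= k < n) increment h y k ^+ 2.

Definition eta_stat (h : R) (n : nat) (y : R -> R) : R :=
  n%:R^-1 * \sum_(0 <= k < n) increment h y k * increment h y k.+1.

Definition zeta_stat (h : R) (n : nat) (y : R -> R) : R :=
  n%:R^-1 * \sum_(0 <= k < n)
    (y (k.+2%:R * h) - y (k%:R * h)) * (y (k.+4%:R * h) - y (k.+2%:R * h)).

(* Subjects are numbered from 0, here and below. *)
Definition average (N : nat) (f : nat -> R) : R :=
  N%:R^-1 * \sum_(0 <= i < N) f i.

Definition U_bar (h : R) (n N : nat) (y : nat -> R -> R) : 'rV[R]_4 :=
  row_seq 4 [:: average N (fun i => theta_hat h n (y i) ^+ 2);
                average N (fun i => xi_stat h n (y i));
                average N (fun i => eta_stat h n (y i));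
                average N (fun i => zeta_stat h n (y i))].

(* Where a denominator vanishes, the estimators below follow x / 0 = 0. *)
Definition log2_plus (x : R) : R := if 0 < x then ln x / ln 2 else 0.

Definition H_hat (h V xi eta zeta : R) : R :=
  2^-1 * log2_plus ((zeta - 4 * h ^+ 2 * V) / (eta - h ^+ 2 * V)).

Definition gamma2_hat (h V xi eta zeta : R) : R :=
  let Hh := H_hat h V xi eta zeta in
  (eta - h ^+ 2 * V) / (h `^ (2 * Hh) * (2 `^ (2 * Hh - 1) - 1)).

Definition sigma2_hat (h V xi eta zeta : R) : R :=
  (xi - h ^+ 2 * V
     - gamma2_hat h V xi eta zeta * h `^ (2 * H_hat h V xi eta zeta)) / h.

Definition Theta_hat (h : R) (u : 'rV[R]_4) : 'rV[R]_3 :=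
  let V := u 0 0 in let xi := u 0 1 in let eta := u 0 2 in let zeta := u 0 3 in
  row_seq 3 [:: H_hat h V xi eta zeta;
                gamma2_hat h V xi eta zeta;
                sigma2_hat h V xi eta zeta].

Definition eta_infty (h H gamma V : R) : R :=
  V * h ^+ 2 + gamma ^+ 2 * h `^ (2 * H) * (2 `^ (2 * H - 1) - 1).

Definition U_infty (h H sigma gamma V : R) : 'rV[R]_4 :=
  row_seq 4
    [:: V;
        V * h ^+ 2 + sigma ^+ 2 * h + gamma ^+ 2 * h `^ (2 * H);
        eta_infty h H gamma V;
        4 * V * h ^+ 2
          + gamma ^+ 2 * h `^ (2 * H) * 2 `^ (2 * H) * (2 `^ (2 * H - 1) - 1)].

Definition D_ (h H : R) : R := h `^ (2 * H) * (2 `^ (2 * H - 1) - 1).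

Definition D'_ (h H : R) : R :=
  h `^ (2 * H) *
  (2 * ln h * (2 `^ (2 * H - 1) - 1) + (2 * ln 2) * 2 `^ (2 * H - 1)).

Definition J_entries (h H gamma B : R) : 'M[R]_(3, 4) :=
  let D := D_ h H in
  let D' := D'_ h H in
  let p := 2 `^ (2 * H) in
  let q := h `^ (2 * H - 1) in
  \matrix_(i < 3, j < 4) (nth [::]
    [:: [:: h ^+ 2 / (2 * ln 2) * ((p - 4) / (p * gamma ^+ 2 * D));
            0;
            - ((2 * ln 2)^-1 * B^-1);
            (2 * ln 2)^-1 * (p * B)^-1];
        [:: - (h ^+ 2 / D) + h ^+ 2 / (2 * ln 2) * (4 / p - 1) * (D' / D ^+ 2);
            0;
            D^-1 + D' / (2 * ln 2) * (D ^+ 2)^-1;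
            - (D' / (2 * ln 2) * (p * D ^+ 2)^-1)];
        [:: - h + q * (h ^+ 2 / D
                       - h ^+ 2 / (2 * ln 2) * (1 - 4 / p)
                         * (- (D' / D ^+ 2) + 2 * ln h / D));
            h^-1;
            - (q * D^-1 * (1 - 2 * ln h / (2 * ln 2)
                           + D' / (2 * ln 2) * D^-1));
            q * 2 `^ (- (2 * H)) * (D' / (2 * ln 2) * (D ^+ 2)^-1
                                    - 2 * ln h / (2 * ln 2) * D^-1)]] i)`_j.

Definition H_vec (h : R) : 'cV[R]_4 :=
  (row_seq 4 [:: 1; h ^+ 2; h ^+ 2; 4 * h ^+ 2])^T.

End statistics.

Section model.
Context (R : realType) (T : Type).

Definition mixed_fBm (sigma gamma : R) (B BH : nat -> R -> T -> R)
    (i : nat) (t : R) (w : T) : R :=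
  sigma * B i t w + gamma * BH i t w.

Definition theta (sigma : R) (phi : nat -> T -> R) (i : nat) (w : T) : R :=
  phi i w - sigma ^+ 2 / 2.

Definition Y_process (sigma gamma : R) (B BH : nat -> R -> T -> R)
    (phi : nat -> T -> R) (i : nat) (t : R) (w : T) : R :=
  theta sigma phi i w * t + mixed_fBm sigma gamma B BH i t w.

End model.

(* Main.v *)
(* The estimator depends on the averages (V, xi, eta, zeta) only through
   xi - h^2 V, eta - h^2 V and zeta - 4 h^2 V, so it is constant along the
   direction H_vec; hence J H_vec = 0 and the limiting covariance J Sigma J^T
   vanishes.  On the probabilistic side, as n tends to infinity with N fixed, the
   limit of the averages is random only through a multiple of H_vec: the three
   combinations above converge in probability to constants, so that Theta_hat
   converges to Theta in probability for each N.  All the limit laws, for fixed N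
   and for N tending to infinity, are thus the Dirac mass at 0.

   By polarization, eta and zeta are combinations of means of squared increments
   of Y over lags 1, 2 and 4.  Expanding these squares leaves means of increments
   and of products of increments of the two Gaussian processes; they obey a weak
   law of large numbers as soon as the correlations of their terms tend to 0.  For
   squared fractional increments the covariance is 2 c^2, where the correlation c
   is half a second difference of x^(2H), which vanishes at infinity as H < 1. *)

Require Import Defs.
From HB Require Import structures.
From mathcomp Require Import all_boot all_order all_algebra.
From mathcomp Require Import finmap.
From mathcomp Require Import all_classical all_reals all_analysis.
From mathcomp Require Import measurable_realfun.
From mathcomp Require Import ring lra.

Set Implicit Arguments.
Unset Strict Implicit.
Unset Printing Implicit Defensive.

Import Order.TTheory GRing.Theory Num.Theory.
Import numFieldNormedType.Exports.

Local Open Scope classical_set_scope.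
Local Open Scope ring_scope.

(** * Moments of the normal distribution *)

(** For fixed N the averages themselves have no constant limit: the average of the squared drift
    estimates tends to the mean of the [theta] squared. Differentiability of [Theta_hat], on the
    other hand, is established at [U_infty], and the estimator is singular elsewhere, for instance
    where eta - h^2 V vanishes. The averages are therefore translated along [H_vec] until their
    first coordinate is [V_infty]. The translated averages converge in probability to [U_infty]
    itself, so continuity at that single point suffices, the factor sqrt N being a constant at this
    stage. The weak laws rest on Chebyshev's inequality and involve only covariances of products of
    two increments. The Gaussian input thus reduces to E X = 0 and E X^4 = 3 (E X^2)^2 for linear
    combinations of two increments: polarizing the second identity gives the mixed moment E[X^2 Y^2]
    without any joint density. These moments are computed from the normal density by integration by
    parts. *)

Section normal_moments.
Context (R : realType) (m s : R).
Hypothesis s_neq0 : s != 0.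
Local Notation mu := (@lebesgue_measure R).
Local Notation nu := (normal_prob m s).
Local Notation pdf := (normal_pdf m s).

(** The Radon-Nikodym derivative is determined only up to a null set; it and [pdf] have the same
    integrals over measurable sets, hence agree almost everywhere. *)
Lemma integral_normal_prob (U : set R) (f : R -> \bar R) :
  measurable U -> nu.-integrable U f ->
  (\int[nu]_(x in U) f x = \int[mu]_(x in U) (f x * (pdf x)%:E))%E.
Proof.
move=> mU intf.
rewrite -(Radon_Nikodym_change_of_variables (normal_prob_dominates m s))//=.
apply: ae_eq_integral => //.
- apply: emeasurable_funM; first exact: measurable_int intf.
  apply: (measurable_int mu); apply: (integrableS _ _ (@subsetT _ _)) => //=.
  by apply: Radon_Nikodym_integrable; exact: normal_prob_dominates.
- apply: emeasurable_funM => //=; first exact: measurable_int intf.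
  by apply/measurable_EFinP/measurable_funTS; exact: measurable_normal_pdf.
- apply: ae_eqe_mul2l => /=.
  rewrite Radon_NikodymE//=; first exact: normal_prob_dominates.
  move=> numu; case: cid => /= h [h1 h2 h3].
  apply: integral_ae_eq => //=.
  + exact: integrableS h2.
  + by apply/measurable_EFinP/measurable_funTS; exact: measurable_normal_pdf.
  + by move=> E E01 mE; rewrite -h3.
Qed.

(** On these compact intervals powers are integrable before any moment of [nu] is known to be
    finite, and the symmetry around m relates the boundary terms at the two ends. *)
Let I (n : nat) : set R := `[m - n.+1%:R, m + n.+1%:R]%classic.

Let mI n : measurable (I n). Proof. exact: measurable_itv. Qed.

Lemma bigcup_centered_itv : \bigcup_n I n = setT.
Proof.
apply/seteqP; split => // x _.
exists (Num.truncn `|x - m|) => //=.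
rewrite /I /= in_itv/=.
have := truncnS_gt `|x - m|.
by rewrite -ler_distlC distrC => /ltW.
Qed.

Lemma is_derive_normal_pdf (x : R) :
  is_derive x 1 pdf (- (x - m) / s ^+ 2 * pdf x).
Proof.
rewrite normal_pdfE//.
rewrite /normal_fun.
apply: is_derive_eq.
rewrite /GRing.scale/=.
by field.
Qed.

(** Decay of order y^-4 is what the boundary terms call for: up to the fourth moment they have
    degree at most 3. *)
Lemma normal_pdf_tail (y : R) : y ^+ 4 * pdf (m + y) <= 16 * s ^+ 4 * normal_peak s.
Proof.
rewrite normal_pdfE// /normal_fun (_ : m + y - m = y); last by ring.
have s2 : 0 < s ^+ 2 by rewrite exprn_even_gt0.
rewrite mulrCA [leRHS]mulrC ler_wpM2l ?normal_peak_ge0//.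
(* [expR (2 u) >= (1 + u) ^+ 2 >= u ^+ 2] *)
set u := y ^+ 2 / (4 * s ^+ 2).
have u0 : 0 <= u by rewrite divr_ge0 ?sqr_ge0// mulr_ge0// ltW.
have -> : - y ^+ 2 / (s ^+ 2 *+ 2) = - (u + u) by rewrite /u; field.
have -> : y ^+ 4 = 16 * s ^+ 4 * u ^+ 2 by rewrite /u; field.
have c0 : 0 <= 16 * s ^+ 4 by apply: mulr_ge0 => //; exact: exprn_even_ge0.
rewrite -[leLHS]mulrA ler_piMr//.
rewrite expRN expRD ler_pdivrMr ?mulr_gt0 ?expR_gt0// mul1r expr2.
have := expR_ge1Dx u => h.
by rewrite ler_pM//; lra.
Qed.

Let nu_integrable_itv (f : R -> R) n : continuous f ->
  nu.-integrable (I n) (EFin \o f).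
Proof.
move=> cf.
have [M [_ Mf]] : bounded_set (f @` I n).
  apply: compact_bounded; apply: continuous_compact; last exact: segment_compact.
  exact: continuous_subspaceT.
apply: (@le_integrable _ _ _ _ _ _ _ (EFin \o cst (M + 1))) => //.
- exact: mI.
- by apply/measurable_EFinP/measurable_funTS; exact: continuous_measurable_fun.
- move=> x Ix /=; rewrite lee_fin.
  rewrite (le_trans _ (ler_norm _))//.
  by apply: (Mf (M + 1)); [rewrite ltrDl|exists x].
- by apply: finite_measure_integrable_cst; exact: mI.
Qed.

Let A k n : R := (\int[nu]_(x in I n) ((x - m) ^+ k))%R.

Let cont_pow k : continuous (fun x : R => (x - m) ^+ k).
Proof.
move=> x; apply: (@continuous_comp _ _ _ (fun x => x - m) (fun x => x ^+ k)).
  by apply: (@cvgB _ R^o); [exact: cvg_id|exact: cvg_cst].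
exact: exprn_continuous.
Qed.

Let A_FTC (f F : R -> R) n : continuous f ->
  (forall x : R, is_derive x 1 F (f x * pdf x)) ->
  (\int[nu]_(x in I n) f x)%R = F (m + n.+1%:R) - F (m - n.+1%:R).
Proof.
move=> cf dF.
have n0 : 0 < n.+1%:R :> R by rewrite ltr0n.
rewrite /Rintegral (integral_normal_prob _ (f := EFin \o f))//; last first.
  exact: nu_integrable_itv.
under eq_integral do rewrite -EFinM.
have cF x : {for x, continuous F}.
  apply: differentiable_continuous; apply/derivable1_diffP.
  by have [] := dF x.
rewrite (@continuous_FTC2 _ _ F) ?ltrD2l//.
- lra.
- apply: continuous_subspaceT => x; apply: cvgM; first exact: cf.
  exact: continuous_normal_pdf.
- split.
  + by move=> x _; have [] := dF x.
  + by apply: cvg_at_right_filter; exact: cF.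
  + by apply: cvg_at_left_filter; exact: cF.
- by move=> x _; rewrite derive1E; exact: derive_val.
Qed.

(** The primitive - s^2 [pdf] takes the same value at both ends of a symmetric interval. *)
Let A_odd n : A 1 n = 0.
Proof.
have dF (x : R) : is_derive x 1 (fun x => - s ^+ 2 * pdf x) ((x - m) ^+ 1 * pdf x).
  have ? := is_derive_normal_pdf x; apply: is_derive_eq.
  by rewrite /GRing.scale/=; field.
rewrite /A (A_FTC _ (@cont_pow 1%N) dF) !normal_pdfE// /normal_fun.
by rewrite (_ : - (m + _ - m) ^+ 2 = - (m - n.+1%:R - m) ^+ 2) ?subrr//; ring.
Qed.

(** Integration by parts: ((x - m)^(k+2) - (k+1) s^2 (x - m)^k) [pdf] is the derivative of - s^2 (x
    - m)^(k+1) [pdf]. *)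
Let A_rec k n : A k.+2 n =
  k.+1%:R * s ^+ 2 * A k n -
  s ^+ 2 * (n.+1%:R ^+ k.+1 * pdf (m + n.+1%:R) - (- n.+1%:R) ^+ k.+1 * pdf (m - n.+1%:R)).
Proof.
rewrite /A.
pose f x := (x - m) ^+ k.+2 - k.+1%:R * s ^+ 2 * (x - m) ^+ k.
have cf1 : continuous (fun x => k.+1%:R * s ^+ 2 * (x - m) ^+ k).
  by move=> x; apply: cvgM; [exact: cvg_cst|exact: cont_pow].
have cf : continuous f.
  by move=> x; apply: (@cvgB _ R^o); [exact: cont_pow|exact: cf1].
have dF (x : R) : is_derive x 1
    (fun x => - s ^+ 2 * ((x - m) ^+ k.+1 * pdf x)) (f x * pdf x).
  have ? := is_derive_normal_pdf x.
  have d1 : is_derive x 1 (fun x => x - m) (1 : R).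
    by apply: is_derive_eq; rewrite subr0.
  have ? := is_deriveX k.+1 d1.
  have -> : (fun x => - s ^+ 2 * ((x - m) ^+ k.+1 * pdf x)) =
      cst (- s ^+ 2) * ((fun x => x - m) ^+ k.+1 * pdf).
    by apply/funext => y; rewrite exprfctE.
  apply: is_derive_eq.
  rewrite exprfctE /f /GRing.scale/= mulr0 addr0 !exprS.
  by field.
have := A_FTC n cf dF.
rewrite /f RintegralB; [|exact: mI|exact: nu_integrable_itv (@cont_pow _)|
  exact: nu_integrable_itv cf1].
rewrite RintegralZl; [|exact: mI|exact: nu_integrable_itv (@cont_pow _)].
move/eqP; rewrite subr_eq => /eqP ->.
rewrite (_ : m + n.+1%:R - m = n.+1%:R); last by ring.
rewrite (_ : m - n.+1%:R - m = - n.+1%:R); last by ring.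
by ring.
Qed.

(** Even powers are nonnegative, so monotone convergence identifies the limit with the full
    integral, whether or not the latter is known to be finite. *)
Let A_cvg_even k : ~~ odd k ->
  (A k n)%:E @[n --> \oo] --> (\int[nu]_x ((x - m) ^+ k)%:E)%E.
Proof.
move=> evk; rewrite -bigcup_centered_itv.
have -> : (fun n => (A k n)%:E) = (fun n => \int[nu]_(x in I n) ((x - m) ^+ k)%:E)%E.
  apply/funext => n; rewrite /A /Rintegral fineK//.
  by apply: integrable_fin_num; [exact: mI|exact: nu_integrable_itv].
apply: ge0_nondecreasing_set_cvg_integral.
- move=> i j ij; apply/subsetPset => x; rewrite /I/= !in_itv/= => /andP[h1 h2].
  have : i.+1%:R <= j.+1%:R :> R by rewrite ler_nat.
  by move=> ?; apply/andP; split; lra.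
- by move=> i; exact: mI.
- by move=> i; apply/measurable_EFinP/measurable_funTS; exact: continuous_measurable_fun.
- by move=> i x _; rewrite lee_fin exprn_even_ge0.
Qed.

Let A_cvg0 : A 0%N n @[n --> \oo] --> (1 : R).
Proof.
have := @A_cvg_even 0%N isT.
rewrite (_ : (\int[nu]_x ((x - m) ^+ 0)%:E)%E = 1%E).
  by move/fine_cvg.
under eq_integral do rewrite expr0.
by rewrite integral_cst// mul1e [LHS]probability_setT.
Qed.

Let pdf_even y : pdf (m - y) = pdf (m + y).
Proof.
rewrite !normal_pdfE// /normal_fun.
by rewrite (_ : - (m - y - m) ^+ 2 = - (m + y - m) ^+ 2)//; ring.
Qed.

Let tail_cvg k : (k <= 3)%N ->
  n.+1%:R ^+ k * pdf (m + n.+1%:R) @[n --> \oo] --> (0 : R).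
Proof.
move=> k3.
pose c := 16 * s ^+ 4 * normal_peak s.
have hc : c * n.+1%:R^-1 @[n --> \oo] --> (0 : R).
  by rewrite -(mulr0 c); apply: cvgM; [exact: cvg_cst|exact: cvg_harmonic].
apply: (squeeze_cvgr _ (cvg_cst 0) hc).
near=> n => /=.
rewrite mulr_ge0 ?exprn_ge0 ?normal_pdf_ge0//=.
have n0 : 0 < n.+1%:R :> R by rewrite ltr0n.
rewrite ler_pdivlMr// (le_trans _ (normal_pdf_tail n.+1%:R))//.
rewrite mulrAC -exprSr ler_wpM2r ?normal_pdf_ge0//.
by apply: ler_weXn2l => //; rewrite ler1n.
Unshelve. all: by end_near. Qed.

(** Since k + 1 is odd and the density is even around m, the two boundary terms add up instead of
    cancelling; [tail_cvg] removes them as long as k + 1 <= 3. *)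
Let A_cvg_rec k a : ~~ odd k -> (k <= 2)%N -> A k n @[n --> \oo] --> (a : R) ->
  A k.+2 n @[n --> \oo] --> (k.+1%:R * s ^+ 2 * a : R).
Proof.
move=> evk k2 Aa.
pose t n := n.+1%:R ^+ k.+1 * pdf (m + n.+1%:R).
have AE n : A k.+2 n = k.+1%:R * s ^+ 2 * A k n - s ^+ 2 * (t n + t n).
  by rewrite A_rec pdf_even exprNn -signr_odd /= evk expr1 mulN1r mulNr opprK.
have t0 : t n @[n --> \oo] --> (0 : R) by exact: tail_cvg.
rewrite (funext AE) (_ : _ * a = k.+1%:R * s ^+ 2 * a - s ^+ 2 * (0 + 0)); last by ring.
apply: (@cvgB _ R^o); apply: cvgM => //; try exact: cvg_cst.
exact: (@cvgD _ R^o).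
Qed.

Let moment_even k a : ~~ odd k -> A k n @[n --> \oo] --> (a : R) ->
  (\int[nu]_x ((x - m) ^+ k)%:E)%E = a%:E.
Proof.
move=> evk Aa; apply: (cvg_unique _ (A_cvg_even evk)) => //.
exact: (cvg_comp _ _ Aa).
Qed.

Let A_cvg2 : A 2 n @[n --> \oo] --> (s ^+ 2 : R).
Proof. by have := @A_cvg_rec 0%N _ isT isT A_cvg0; rewrite mul1r mulr1. Qed.

Lemma normal_prob_moment2 : (\int[nu]_x ((x - m) ^+ 2)%:E = (s ^+ 2)%:E)%E.
Proof. exact: (@moment_even 2%N _ isT A_cvg2). Qed.

Lemma normal_prob_moment4 : (\int[nu]_x ((x - m) ^+ 4)%:E = (3 * s ^+ 4)%:E)%E.
Proof.
apply: (@moment_even 4%N _ isT).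
by have := @A_cvg_rec 2%N _ isT isT A_cvg2; rewrite -mulrA -exprD.
Qed.

Let continuous_center : continuous (fun x : R => x - m).
Proof. exact: (@cont_pow 1%N). Qed.

Let measurable_continuous (f : R -> R) :
  continuous f -> measurable_fun setT (EFin \o f).
Proof. by move=> cf; apply/measurable_EFinP; exact: continuous_measurable_fun. Qed.

Let integrable_dom : nu.-integrable setT (fun x => (1 + (x - m) ^+ 2)%:E).
Proof.
apply/integrableP; split.
  apply: measurable_continuous => x; apply: (@cvgD _ R^o); first exact: cvg_cst.
  exact: cont_pow.
under eq_integral do rewrite /= ger0_norm ?addr_ge0 ?sqr_ge0// EFinD.
rewrite ge0_integralD//=.
- rewrite normal_prob_moment2 integral_cst//= mul1e.
  by rewrite [X in (X + _)%E]probability_setT ltry.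
- by move=> x _; rewrite lee_fin sqr_ge0.
- exact: (measurable_continuous (@cont_pow 2)).
Qed.

Let center_dom (x : R) : `|x - m| <= 1 + (x - m) ^+ 2.
Proof.
set y := x - m.
have := sqr_ge0 (y - 1); have := sqr_ge0 (y + 1); have := sqr_ge0 y.
by rewrite !expr2 => *; apply/ler_normlP; split; lra.
Qed.

Lemma integrable_normal_prob_center : nu.-integrable setT (fun x => (x - m)%:E).
Proof.
apply: (le_integrable measurableT _ _ integrable_dom).
  exact: measurable_continuous.
by move=> x _; rewrite lee_fin (le_trans (center_dom x))// ler_norm.
Qed.

(** The integrand changes sign, so dominated convergence replaces monotone convergence, with bound 1
    + (x - m)^2; all truncated integrals are 0. *)
Lemma normal_prob_moment1 : (\int[nu]_x (x - m)%:E = 0)%E.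
Proof.
have := @dominated_cvg _ _ _ nu setT measurableT
  (fun n => ((fun x => (x - m)%:E) \_ (I n))%E) (fun x => (x - m)%:E)
  (fun x => (1 + (x - m) ^+ 2)%:E).
move=> /(_ _ _ _ integrable_dom) h.
have {}h : (A 1 n)%:E @[n --> \oo] --> (\int[nu]_x (x - m)%:E)%E.
  rewrite (_ : (fun n => _) = fun n => \int[nu]_x ((fun x => (x - m)%:E) \_ (I n))%E x)%E.
    apply: h => //.
    - move=> n; apply/(measurable_restrictT _ (mI n)); apply: measurable_funTS.
      exact: measurable_continuous.
    - move=> x _; apply: cvg_near_cst.
      have [N _ IN] : (\bigcup_n I n) x by rewrite bigcup_centered_itv.
      exists N => // n /= Nn; rewrite patchE mem_set//.
      move: IN; rewrite /I/= !in_itv/= => /andP[h1 h2].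
      have : N.+1%:R <= n.+1%:R :> R by rewrite ler_nat.
      by move=> ?; apply/andP; split; lra.
    - move=> n x _; rewrite patchE; case: ifP => _; last first.
        by rewrite abse0 lee_fin addr_ge0// sqr_ge0.
      by rewrite lee_fin center_dom.
  apply/funext => n; rewrite -integral_mkcond /A /Rintegral fineK//.
  by apply: integrable_fin_num; [exact: mI|exact: nu_integrable_itv].
apply: (cvg_unique _ h) => //.
rewrite (_ : (fun n => (A 1 n)%:E) = cst 0%E); first exact: cvg_cst.
by apply/funext => n; rewrite A_odd.
Qed.

End normal_moments.

(** * Fourth moments and Gaussian polarization *)

Section moments.
Context (R : realType) (d : measure_display) (T : measurableType d)
  (P : probability T R).
Implicit Types X Y Z f g : T -> R.

Local Notation E f := (\int[P]_w f w)%R.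
Local Notation intg f := (P.-integrable setT (EFin \o f)).

Lemma integrableT_D f g : intg f -> intg g -> intg (fun w => f w + g w).
Proof. by move=> hf hg; exact: (integrableD measurableT hf hg). Qed.

Lemma integrableT_Z c f : intg f -> intg (fun w => c * f w).
Proof. by move=> intf; exact: (integrableZl measurableT c intf). Qed.

Lemma RintegralT_D f g : intg f -> intg g -> E (fun w => f w + g w) = E f + E g.
Proof. by move=> hf hg; rewrite RintegralD. Qed.

Lemma RintegralT_Z c f : intg f -> E (fun w => c * f w) = c * E f.
Proof. by move=> intf; rewrite RintegralZl. Qed.

Lemma RintegralT_cst c : E (fun=> c) = c.
Proof. by rewrite Rintegral_cst// [X in fine X]probability_setT mulr1. Qed.

(** The space L^4: stable under linear combinations, and any product of at most four members is
    integrable, which covers the covariances of products of two increments. *)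
Definition finite_moment4 X :=
  measurable_fun setT X /\ intg (fun w => X w ^+ 4).

Lemma finite_moment4_cst c : finite_moment4 (fun=> c).
Proof.
by split; [exact: measurable_cst|exact: finite_measure_integrable_cst].
Qed.

Lemma dominated_integrableT f g : measurable_fun setT f -> intg g ->
  (forall w, `|f w| <= g w) -> intg f.
Proof.
move=> mf ig fg; apply: (le_integrable measurableT _ _ ig).
  exact/measurable_EFinP.
by move=> w _; rewrite lee_fin (le_trans (fg w))// ler_norm.
Qed.

(** Applying |x y| <= x^2 + y^2 twice bounds the product by the sum of the four fourth powers. *)
Lemma finite_moment4_integrable X1 X2 X3 X4 :
  finite_moment4 X1 -> finite_moment4 X2 -> finite_moment4 X3 ->
  finite_moment4 X4 -> intg (fun w => X1 w * X2 w * X3 w * X4 w).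
Proof.
move=> [m1 i1] [m2 i2] [m3 i3] [m4 i4].
apply: (@dominated_integrableT _
  (fun w => (X1 w ^+ 4 + X2 w ^+ 4) + (X3 w ^+ 4 + X4 w ^+ 4))).
- by do 3 apply: measurable_funM => //.
- by do 2 apply: integrableT_D => //; apply: integrableT_D.
move=> w.
have prod_le (x y : R) : `|x * y| <= x ^+ 2 + y ^+ 2.
  have := sqr_ge0 (x - y); have := sqr_ge0 (x + y); have := sqr_ge0 x.
  have := sqr_ge0 y; rewrite !expr2 => *; apply/ler_normlP; split; lra.
have sq_le (x y : R) : (x * y) ^+ 2 <= x ^+ 4 + y ^+ 4.
  have := prod_le (x ^+ 2) (y ^+ 2).
  by rewrite -exprMn ger0_norm ?sqr_ge0// -!exprM.
by rewrite -mulrA (le_trans (prod_le _ _))// lerD.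
Qed.

Lemma finite_moment4_integrable3 X1 X2 X3 : finite_moment4 X1 ->
  finite_moment4 X2 -> finite_moment4 X3 -> intg (fun w => X1 w * X2 w * X3 w).
Proof.
move=> h1 h2 h3.
have := finite_moment4_integrable h1 h2 h3 (finite_moment4_cst 1).
by congr (_.-integrable _ _); apply/funext => w /=; rewrite mulr1.
Qed.

Lemma finite_moment4_integrable2 X1 X2 : finite_moment4 X1 ->
  finite_moment4 X2 -> intg (fun w => X1 w * X2 w).
Proof.
move=> h1 h2.
have := finite_moment4_integrable3 h1 h2 (finite_moment4_cst 1).
by congr (_.-integrable _ _); apply/funext => w /=; rewrite mulr1.
Qed.

Lemma finite_moment4_integrable1 X : finite_moment4 X -> intg X.
Proof.
move=> h1; have := finite_moment4_integrable2 h1 (finite_moment4_cst 1).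
by congr (_.-integrable _ _); apply/funext => w /=; rewrite mulr1.
Qed.

Lemma finite_moment4_sqr_integrable X : finite_moment4 X ->
  intg (fun w => X w ^+ 2).
Proof. by move=> h; exact: finite_moment4_integrable2. Qed.

Lemma finite_moment4D X Y : finite_moment4 X -> finite_moment4 Y ->
  finite_moment4 (fun w => X w + Y w).
Proof.
move=> hX hY; have [mX _] := hX; have [mY _] := hY.
split; first exact: measurable_funD.
have -> : (fun w => (X w + Y w) ^+ 4) = (fun w =>
  (X w * X w * X w * X w + 4 * (X w * X w * X w * Y w)) +
  (6 * (X w * X w * Y w * Y w) +
   (4 * (X w * Y w * Y w * Y w) + Y w * Y w * Y w * Y w))).
  by apply/funext => w; ring.
by do ?apply: integrableT_D; do ?apply: integrableT_Z;
  exact: finite_moment4_integrable.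
Qed.

Lemma finite_moment4Z c X : finite_moment4 X ->
  finite_moment4 (fun w => c * X w).
Proof.
move=> [mX iX]; split; first exact: measurable_funM.
have -> : (fun w => (c * X w) ^+ 4) = (fun w => c ^+ 4 * X w ^+ 4).
  by apply/funext => w; rewrite exprMn.
exact: integrableT_Z.
Qed.

(** For nonnegative f no integrability is asked, so this transfer itself yields the finiteness of
    the even moments. *)
Lemma is_normal_integral X (m v : R) (f : R -> \bar R) :
  measurable_fun setT X -> is_normal (pushforward P X) m v ->
  measurable_fun setT f -> (forall x, 0 <= f x)%E ->
  (\int[P]_w f (X w) =
   if (v == 0)%R then f m else \int[normal_prob m (Num.sqrt v)]_x f x)%E.
Proof.
move=> mX [v0 law] mf f0.
rewrite -(@ge0_integral_pushforward _ _ _ _ _ _ mX P setT f)//.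
case: ifPn => v_eq0.
  rewrite (@eq_measure_integral _ _ _ _ (\d_m)).
    by rewrite integral_dirac//= diracT mul1e.
  by move=> A mA _; rewrite /= law// v_eq0.
(* [normal_prob] lives on [measurableTypeR R], whose display is not that of [R]:
   the identity transports it. *)
have mid : measurable_fun [set: measurableTypeR R] (id : measurableTypeR R -> R) by [].
rewrite -(@ge0_integral_pushforward _ _ _ _ _ _ mid (normal_prob m (Num.sqrt v)) setT f)//.
apply: eq_measure_integral => A mA _.
by rewrite /= law// (negbTE v_eq0).
Qed.

Lemma is_normal_moments X (m v : R) :
  measurable_fun setT X -> is_normal (pushforward P X) m v ->
  [/\ finite_moment4 X, E X = m, E (fun w => (X w - m) ^+ 2) = v &
      E (fun w => (X w - m) ^+ 4) = 3 * v ^+ 2].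
Proof.
move=> mX law; have v0 := law.1.
have mpow k : measurable_fun setT (fun x : R => ((x - m) ^+ k)%:E).
  by apply/measurable_EFinP; apply: measurable_funX; exact: measurable_funB.
have E2 : (\int[P]_w ((X w - m) ^+ 2)%:E)%E = v%:E.
  rewrite (is_normal_integral mX law (mpow 2%N)); last first.
    by move=> x; rewrite lee_fin sqr_ge0.
  case: ifPn => [/eqP ->|v_neq0]; first by rewrite subrr expr0n.
  by rewrite normal_prob_moment2 ?sqr_sqrtr// sqrtr_eq0 -ltNge lt_def v_neq0.
have E4 : (\int[P]_w ((X w - m) ^+ 4)%:E)%E = (3 * v ^+ 2)%:E.
  rewrite (is_normal_integral mX law (mpow 4%N)); last first.
    by move=> x; rewrite lee_fin exprn_even_ge0.
  case: ifPn => [/eqP ->|v_neq0]; first by rewrite subrr !expr0n/= mulr0.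
  rewrite normal_prob_moment4; last by rewrite sqrtr_eq0 -ltNge lt_def v_neq0.
  by rewrite (exprM _ 2 2) sqr_sqrtr.
have fm4' : finite_moment4 (fun w => X w - m).
  split; first exact: measurable_funB.
  apply/integrableP; split.
    by apply/measurable_EFinP; apply: measurable_funX; exact: measurable_funB.
  under eq_integral do rewrite /= ger0_norm ?exprn_even_ge0//.
  by rewrite E4 ltry.
have fm4 : finite_moment4 X.
  have := finite_moment4D fm4' (finite_moment4_cst m).
  by congr finite_moment4; apply/funext => w; rewrite subrK.
split => //; [|by rewrite /Rintegral E2|by rewrite /Rintegral E4].
(* The mean is a signed integral, out of reach of [is_normal_integral]: the law is transferred
   again, now with the integrability just obtained. *)
suff : E (fun w => X w - m) = 0.
  rewrite RintegralB//; last 2 first.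
  - exact: finite_moment4_integrable1.
  - exact: finite_moment4_integrable1 (finite_moment4_cst m).
  by rewrite RintegralT_cst => /eqP; rewrite subr_eq0 => /eqP.
rewrite /Rintegral.
rewrite -(@integral_pushforward _ _ _ _ _ _ mX P setT
  (fun x => (x - m)%:E))//; last 2 first.
- exact: (mpow 1%N).
- exact: finite_moment4_integrable1.
have [v_eq0|v_neq0] := eqVneq v 0.
  rewrite (@eq_measure_integral _ _ _ _ (\d_m)).
    by rewrite integral_dirac ?diracT ?mul1e ?subrr//; exact: (mpow 1%N).
  by move=> A mA _; rewrite /= law.2// v_eq0 eqxx.
have s_neq0 : Num.sqrt v != 0 by rewrite sqrtr_eq0 -ltNge lt_def v_neq0.
have mid : measurable_fun [set: measurableTypeR R] (id : measurableTypeR R -> R) by [].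
have := @normal_prob_moment1 R m _ s_neq0.
rewrite -(@integral_pushforward _ _ _ _ _ _ mid (normal_prob m (Num.sqrt v)) setT
  (fun x => (x - m)%:E))//; last 2 first.
- exact: (mpow 1%N).
- exact: integrable_normal_prob_center.
move=> E1; transitivity (fine 0%E : R) => //; rewrite -E1; congr fine.
apply: eq_measure_integral => A mA _.
by rewrite /= law.2// (negbTE v_neq0).
Qed.

(* All that is used of centered Gaussian variables. *)
Definition gaussian_moments X :=
  [/\ finite_moment4 X, E X = 0 &
      E (fun w => X w ^+ 4) = 3 * E (fun w => X w ^+ 2) ^+ 2].

Lemma is_normal_gaussian_moments X (m v : R) :
  measurable_fun setT X -> is_normal (pushforward P X) m v -> E X = 0 ->
  gaussian_moments X.
Proof.
move=> mX law EX; have [fX Em E2 E4] := is_normal_moments mX law.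
have m0 : m = 0 by rewrite -Em.
move: E2 E4; rewrite m0.
under eq_Rintegral do rewrite subr0.
move=> E2; under eq_Rintegral do rewrite subr0.
by rewrite -E2.
Qed.

(* Polarization of the fourth moment: (X + Y)^4 + (X - Y)^4. *)
Lemma gaussian_moments_sqr_sqr X Y :
  gaussian_moments X -> gaussian_moments Y ->
  gaussian_moments (fun w => X w + Y w) ->
  gaussian_moments (fun w => X w - Y w) ->
  E (fun w => X w ^+ 2 * Y w ^+ 2) =
  E (fun w => X w ^+ 2) * E (fun w => Y w ^+ 2) + 2 * E (fun w => X w * Y w) ^+ 2.
Proof.
move=> [fX _ X4] [fY _ Y4] [fD _ D4] [fB _ B4].
have iX2 := finite_moment4_sqr_integrable fX.
have iY2 := finite_moment4_sqr_integrable fY.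
have iXY := finite_moment4_integrable2 fX fY.
have i2 : intg (fun w => X w ^+ 2 + Y w ^+ 2) by exact: integrableT_D.
have D2 : E (fun w => (X w + Y w) ^+ 2) =
    E (fun w => X w ^+ 2) + E (fun w => Y w ^+ 2) + 2 * E (fun w => X w * Y w).
  rewrite -RintegralT_D// -RintegralT_Z// -RintegralT_D//; last exact: integrableT_Z.
  by apply: eq_Rintegral => w _; ring.
have B2 : E (fun w => (X w - Y w) ^+ 2) =
    E (fun w => X w ^+ 2) + E (fun w => Y w ^+ 2) + - 2 * E (fun w => X w * Y w).
  rewrite -RintegralT_D// -RintegralT_Z// -RintegralT_D//; last exact: integrableT_Z.
  by apply: eq_Rintegral => w _; ring.
have iXXYY : intg (fun w => X w ^+ 2 * Y w ^+ 2).
  have := finite_moment4_integrable fX fX fY fY.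
  by congr (_.-integrable _ _); apply/funext => w /=; congr EFin; ring.
have iX4 := fX.2; have iY4 := fY.2.
have : E (fun w => (X w + Y w) ^+ 4) + E (fun w => (X w - Y w) ^+ 4) =
    2 * E (fun w => X w ^+ 4) +
    (12 * E (fun w => X w ^+ 2 * Y w ^+ 2) + 2 * E (fun w => Y w ^+ 4)).
  have iD4 := fD.2; have iB4 := fB.2.
  have iX := integrableT_Z 2 iX4; have iY := integrableT_Z 2 iY4.
  have iXY' := integrableT_Z 12 iXXYY.
  have iXYY := integrableT_D iXY' iY.
  rewrite -!RintegralT_Z// -!RintegralT_D//.
  by apply: eq_Rintegral => w _; ring.
rewrite D4 B4 X4 Y4 D2 B2.
move: (E (fun w => X w ^+ 2)) (E (fun w => Y w ^+ 2)) (E (fun w => X w * Y w)).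
(* The hypothesis h reads 3 (a + b + 2 c)^2 + 3 (a + b - 2 c)^2 = 6 a^2 + 12 E[X^2 Y^2] + 6 b^2. *)
move=> a b c h; have : 12 * E (fun w => X w ^+ 2 * Y w ^+ 2) =
    12 * (a * b + 2 * c ^+ 2) by nra.
by move/mulfI; apply.
Qed.

End moments.

(** * Independence *)

Section independence_expectation.
Context (R : realType) (d : measure_display) (T : measurableType d)
  (P : probability T R).
Implicit Types X Y : T -> R.

Local Notation intg f := (P.-integrable setT (EFin \o f)).

(** The joint law of (X, Y) agrees with the product of the marginal laws on rectangles, hence on all
    measurable sets; Fubini's theorem for the product then separates the integrals. *)
Lemma independent2_expectationM X Y :
  measurable_fun setT X -> measurable_fun setT Y ->
  intg X -> intg Y -> intg (fun w => X w * Y w) ->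
  independent2 P (g_sigma_algebra_preimage X) (g_sigma_algebra_preimage Y) ->
  (\int[P]_w (X w * Y w) = (\int[P]_w X w) * (\int[P]_w Y w))%R.
Proof.
move=> mX mY iX iY iXY indep.
pose Xm : {RV P >-> R} := HB.pack X (isMeasurableFun.Build _ _ _ _ _ mX).
pose Ym : {RV P >-> R} := HB.pack Y (isMeasurableFun.Build _ _ _ _ _ mY).
have mZ : measurable_fun setT (fun w => (X w, Y w)) by exact: measurable_fun_pair.
pose Zm : {RV P >-> (R * R)%type} :=
  HB.pack (fun w => (X w, Y w)) (isMeasurableFun.Build _ _ _ _ _ mZ).
have prodE (A : set (R * R)) : measurable A ->
    (distribution P Xm \x distribution P Ym)%E A = distribution P Zm A.
  apply: product_measure_unique => A1 A2 mA1 mA2.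
  apply: indep.
    by exists A1 => //; rewrite setTI.
  by exists A2 => //; rewrite setTI.
have mf : measurable_fun [set: R * R] (fun z : R * R => (z.1 * z.2)%:E).
  by apply/measurable_EFinP; exact: measurable_funM.
have iZ : (distribution P Xm \x distribution P Ym)%E.-integrable setT
    (fun z : R * R => (z.1 * z.2)%:E).
  apply/integrableP; split => //.
  rewrite (@eq_measure_integral _ _ _ _ (distribution P Zm)); last first.
    by move=> A mA _; exact: prodE.
  rewrite ge0_integral_distribution//; last exact: measurableT_comp.
  by case/integrableP : iXY.
have -> : (\int[P]_w (X w * Y w))%R =
    fine (\int[distribution P Xm \x distribution P Ym]_z (z.1 * z.2)%:E)%E.
  rewrite (@eq_measure_integral _ _ _ _ (distribution P Zm)); last first.
    by move=> A mA _; exact: prodE.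
  by rewrite integral_distribution.
have mid : measurable_fun [set: R] (fun y : R => y%:E) by exact/measurable_EFinP.
have EY : (\int[distribution P Ym]_y y%:E)%E = (\int[P]_w Y w)%R%:E.
  rewrite integral_distribution//.
  by rewrite /Rintegral fineK//; exact: integrable_fin_num.
have iYd : (distribution P Ym).-integrable setT (fun y : R => y%:E).
  exact: integrable_pushforward.
have iXd : (distribution P Xm).-integrable setT (fun y : R => y%:E).
  exact: integrable_pushforward.
rewrite -integral12_prod_meas1//.
rewrite (eq_integral (fun x : R => x%:E * (\int[P]_w Y w)%R%:E)%E); last first.
  by move=> x _; rewrite /fubini_F -EY -integralZl.
rewrite integralZr// integral_distribution// fineM//.
exact: integrable_fin_num.
Qed.

End independence_expectation.

(** * Convergence in probability and a weak law *)

Section convergence_in_probability.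
Context (R : realType) (d : measure_display) (T : measurableType d)
  (P : probability T R).
Implicit Types X Y : nat -> T -> R.

Local Notation E f := (\int[P]_w f w)%R.
Local Notation intg f := (P.-integrable setT (EFin \o f)).

(** Only the limit 0 is considered: a random limit such as [theta] is first subtracted from the
    sequence. *)
Definition cvg_prob0 X :=
  (forall n, measurable_fun setT (X n)) /\
  forall e : R, 0 < e -> (P [set w | (e <= `|X n w|)%R] @[n --> \oo] --> 0)%E.

Lemma measurable_abs_ge (f : T -> R) (e : R) :
  measurable_fun setT f -> measurable [set w | e <= `|f w|].
Proof.
move=> mf; have mnf : measurable_fun setT (fun w => `|f w|).
  exact: measurableT_comp.
have := mnf measurableT `[e, +oo[%classic (measurable_itv _).
by rewrite setTI; congr measurable; apply/seteqP; split => w /=;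
  rewrite in_itv/= andbT.
Qed.

Lemma squeeze_cvge0 (u v : nat -> \bar R) : (forall n, 0 <= u n <= v n)%E ->
  v n @[n --> \oo] --> 0%E -> u n @[n --> \oo] --> 0%E.
Proof.
move=> uv v0; apply: (squeeze_cvge _ (cvg_cst 0%E) v0).
by near=> n; exact: uv.
Unshelve. all: by end_near. Qed.

Lemma ge0_cvge0P (u : nat -> \bar R) : (forall n, 0 <= u n)%E ->
  u n @[n --> \oo] --> 0%E <->
  forall e : R, 0 < e -> \forall n \near \oo, (u n <= e%:E)%E.
Proof.
move=> u0; split => [/fine_cvgP[ufin u_cvg] e e0|ue].
  have /cvgr0Pnorm_le/(_ e e0) un := u_cvg.
  near=> n; have ufn : u n \is a fin_num by near: n.
  rewrite -(fineK ufn) lee_fin (le_trans (ler_norm _))//.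
  by near: n.
have ufin : \forall n \near \oo, u n \is a fin_num.
  near=> n; rewrite ge0_fin_numE// (@le_lt_trans _ _ 1%:E) ?ltry//.
  by near: n; exact: ue.
apply/fine_cvgP; split => //; apply/cvgr0Pnorm_le => e e0.
near=> n; rewrite ger0_norm ?fine_ge0// -lee_fin fineK; last by near: n.
by near: n; exact: ue.
Unshelve. all: by end_near. Qed.

Lemma cvg_prob0D X Y : cvg_prob0 X -> cvg_prob0 Y ->
  cvg_prob0 (fun n w => X n w + Y n w).
Proof.
move=> [mX X0] [mY Y0]; split => [n|e e0]; first exact: measurable_funD.
have e20 : 0 < e / 2 by rewrite divr_gt0.
apply: (@squeeze_cvge0 _ (fun n => P [set w | (e / 2 <= `|X n w|)%R] +
    P [set w | (e / 2 <= `|Y n w|)%R])%E); last first.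
  by rewrite -(adde0 0%E); apply: cvgeD => //; [exact: X0|exact: Y0].
move=> n; rewrite measure_ge0/=.
have mXe := measurable_abs_ge (e / 2) (mX n).
have mYe := measurable_abs_ge (e / 2) (mY n).
apply: le_trans (measureU2 _ mXe mYe).
apply: le_measure; rewrite ?inE.
- by apply: measurable_abs_ge; exact: measurable_funD.
- exact: measurableU.
move=> w /= ew; have [Xe|Xe] := leP (e / 2) `|X n w|; first by left.
right; have := le_trans ew (ler_normD _ _); lra.
Qed.

(** Thresholds 1 and e suffice: if |X Y| >= e and |X| < 1, then |Y| >= e. *)
Lemma cvg_prob0M X Y : cvg_prob0 X -> cvg_prob0 Y ->
  cvg_prob0 (fun n w => X n w * Y n w).
Proof.
move=> [mX X0] [mY Y0]; split => [n|e e0]; first exact: measurable_funM.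
apply: (@squeeze_cvge0 _ (fun n => P [set w | (1 <= `|X n w|)%R] +
    P [set w | (e <= `|Y n w|)%R])%E); last first.
  by rewrite -(adde0 0%E); apply: cvgeD => //; [exact: X0|exact: Y0].
move=> n; rewrite measure_ge0/=.
have mXe := measurable_abs_ge 1 (mX n).
have mYe := measurable_abs_ge e (mY n).
apply: le_trans (measureU2 _ mXe mYe).
apply: le_measure; rewrite ?inE.
- by apply: measurable_abs_ge; exact: measurable_funM.
- exact: measurableU.
move=> w /=; rewrite normrM => ew.
have [Xe|Xe] := leP 1 `|X n w|; first by left.
right; apply: (le_trans ew); rewrite ler_piMl//; exact: ltW.
Qed.

(** Tightness of one real variable: the events decrease to the empty set. *)
Lemma probability_abs_ge_cvg0 (f : T -> R) : measurable_fun setT f ->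
  (P [set w | (n%:R <= `|f w|)%R] @[n --> \oo] --> 0)%E.
Proof.
move=> mf; pose F n := [set w | n%:R <= `|f w|].
have FI : \bigcap_n F n = set0.
  apply/seteqP; split => // w Fw.
  have := Fw (Num.truncn `|f w|).+1 I; rewrite /F/= leNgt.
  by rewrite truncnS_gt.
have mF n : measurable (F n) by exact: measurable_abs_ge.
have := @nonincreasing_cvg_mu _ _ _ P F; rewrite FI measure0; apply => //.
- by rewrite (le_lt_trans (probability_le1 _ (mF 0%N)))// ltry.
- move=> i j ij; apply/subsetPset => w; rewrite /F/= => jf.
  by apply: le_trans jf; rewrite ler_nat.
Qed.

(** This lets the random effect multiply a weak law with no moment assumption on it: off an event of
    small probability f is bounded by some c, and then |f X| >= e forces |X| >= e / c. *)
Lemma cvg_prob0Ml X (f : T -> R) : measurable_fun setT f -> cvg_prob0 X ->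
  cvg_prob0 (fun n w => f w * X n w).
Proof.
move=> mf [mX X0]; split => [n|e e0]; first exact: measurable_funM.
apply/ge0_cvge0P => [n|eps eps0]; first exact: measure_ge0.
have eps20 : 0 < eps / 2 by rewrite divr_gt0.
have /ge0_cvge0P/(_ _ eps20)[//|N _ fN] := probability_abs_ge_cvg0 mf.
(* N + 1 instead of N, to make c positive. *)
pose c : R := N.+1%:R.
have c0 : 0 < c by rewrite ltr0n.
have /ge0_cvge0P/(_ _ eps20)[//|M _ XM] := X0 _ (divr_gt0 e0 c0).
exists M => // n Mn /=.
have mfc := measurable_abs_ge c mf.
have mXe := measurable_abs_ge (e / c) (mX n).
rewrite (splitr eps) EFinD (le_trans _ (leeD (fN N.+1 _) (XM n Mn)))//=.
apply: le_trans (measureU2 _ mfc mXe).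
apply: le_measure; rewrite ?inE.
- by apply: measurable_abs_ge; exact: measurable_funM.
- exact: measurableU.
move=> w /=; rewrite normrM => ew.
have [fc|fc] := leP c `|f w|; first by left.
right; rewrite ler_pdivrMr// mulrC (le_trans ew)// ler_wpM2r//; exact: ltW.
Qed.

Lemma cvg_prob0Z X (c : R) : cvg_prob0 X -> cvg_prob0 (fun n w => c * X n w).
Proof. by move=> X0; apply: cvg_prob0Ml. Qed.

Lemma RintegralT_sum (Z : nat -> T -> R) n :
  (forall k, intg (Z k)) ->
  intg (fun w => \sum_(0 <= k < n) Z k w) /\
  E (fun w => \sum_(0 <= k < n) Z k w) = \sum_(0 <= k < n) E (Z k).
Proof.
move=> iZ; elim: n => [|n [ihi ihE]].
  have -> : (fun w => \sum_(0 <= k < 0) Z k w) = (fun=> 0).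
    by apply/funext => w; rewrite big_nil.
  by rewrite big_nil RintegralT_cst; split => //; exact: finite_measure_integrable_cst.
have -> : (fun w => \sum_(0 <= k < n.+1) Z k w) =
    (fun w => \sum_(0 <= k < n) Z k w + Z n w).
  by apply/funext => w; rewrite big_nat_recr.
split; first exact: integrableT_D.
by rewrite big_nat_recr//= -ihE RintegralT_D.
Qed.

Section weak_law.
Variables (Z : nat -> T -> R) (r : nat -> R).
Hypothesis mZ : forall k, measurable_fun setT (Z k).
Hypothesis iZZ : forall k l, intg (fun w => Z k w * Z l w).
Hypothesis corr : forall k j, `|E (fun w => Z k w * Z (k + j)%N w)| <= r j.

Let S n w := \sum_(0 <= k < n) Z k w.

Let r_ge0 j : 0 <= r j. Proof. exact: le_trans (corr 0 j). Qed.

(** Induction on n: the new term meets each earlier one at a different lag, so the step costs at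
    most r 0 + 2 (r 1 + ... + r n). *)
Lemma sum_second_moment n : intg (fun w => S n w ^+ 2) /\
  E (fun w => S n w ^+ 2) <= 2 * n%:R * \sum_(0 <= j < n) r j.
Proof.
elim: n => [|n [ihi ihE]].
  have -> : (fun w => S 0 w ^+ 2) = (fun=> 0).
    by apply/funext => w; rewrite /S big_nil expr0n.
  rewrite RintegralT_cst !mulr0 mul0r; split => //.
  exact: finite_measure_integrable_cst.
have [iC EC] := RintegralT_sum n (fun k => iZZ k n).
have iD : intg (fun w => 2 * (\sum_(0 <= k < n) Z k w * Z n w) + Z n w * Z n w).
  by apply: integrableT_D => //; exact: integrableT_Z.
have -> : (fun w => S n.+1 w ^+ 2) = (fun w =>
    S n w ^+ 2 + (2 * (\sum_(0 <= k < n) Z k w * Z n w) + Z n w * Z n w)).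
  by apply/funext => w; rewrite /S big_nat_recr//= -mulr_suml; ring.
split; first exact: integrableT_D.
rewrite RintegralT_D// RintegralT_D//; last exact: integrableT_Z.
rewrite RintegralT_Z// EC.
have le_sum : \sum_(0 <= k < n) E (fun w => Z k w * Z n w) <= \sum_(0 <= j < n) r j.+1.
  (* Reversing the sum pairs the index k with its lag n - k. *)
  rewrite [leRHS]big_nat_rev/= add0n; apply: ler_sum_nat => k /= kn.
  rewrite (le_trans (ler_norm _))// (le_trans _ (corr k _))// subnSK//.
  by rewrite subnKC// ltnW.
have le_last : E (fun w => Z n w * Z n w) <= r 0.
  by rewrite (le_trans (ler_norm _))// (le_trans _ (corr n _))// addn0.
have sumE : r 0 + \sum_(0 <= j < n) r j.+1 = \sum_(0 <= j < n.+1) r j.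
  by rewrite [RHS]big_nat_recl.
have sum_le : \sum_(0 <= j < n) r j <= \sum_(0 <= j < n.+1) r j.
  by rewrite big_nat_recr//= lerDl.
have sum0 : 0 <= \sum_(0 <= j < n.+1) r j by exact: sumr_ge0.
have r00 := r_ge0 0.
rewrite (le_trans (lerD ihE (lerD (ler_wpM2l _ le_sum) le_last)))//.
have : 2 * n%:R * \sum_(0 <= j < n) r j <= 2 * n%:R * \sum_(0 <= j < n.+1) r j.
  by rewrite ler_wpM2l// mulr_ge0.
rewrite -(natr1 n) -sumE; move: sumE; lra.
Qed.

(* Chebyshev's inequality; the variance is bounded by a Cesaro mean of [r]. *)
Lemma weak_law : r j @[j --> \oo] --> (0 : R) ->
  cvg_prob0 (fun n w => n%:R^-1 * \sum_(0 <= k < n) Z k w).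
Proof.
move=> r0; have mS n : measurable_fun setT (fun w => n%:R^-1 * S n w).
  by apply: measurable_funM => //; exact: measurable_sum.
split => // e e0.
pose b n : R := (e ^+ 2)^-1 * (2 * (n%:R^-1 * \sum_(0 <= j < n) r j)).
have b0 : b n @[n --> \oo] --> (0 : R).
  rewrite -[X in _ --> X](mulr0 (e ^+ 2)^-1) -[in X in _ --> X](mulr0 2).
  do 2 (apply: cvgM; first exact: cvg_cst).
  (* [cesaro] concerns means of n + 1 terms, hence the shift. *)
  by rewrite -cvg_shiftS; exact: cesaro.
apply: (@squeeze_cvge0 _ (fun n => (b n)%:E)); last first.
  exact: (cvg_comp _ _ b0).
move=> n; rewrite measure_ge0/=.
pose Sm : {RV P >-> R} :=
  HB.pack (fun w => n%:R^-1 * S n w) (isMeasurableFun.Build _ _ _ _ _ (mS n)).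
have [iS ES] := sum_second_moment n.
have := @markov _ _ _ P Sm (fun x => x ^+ 2) e e0.
rewrite unlock => /(_ _ _ _)/=.
have -> : (\int[P]_w (`|n%:R^-1 * S n w| ^+ 2)%:E =
    (n%:R^-1 ^+ 2 * E (fun w => S n w ^+ 2))%:E)%E.
  rewrite -RintegralT_Z// fineK; last first.
    by apply: integrable_fin_num => //; exact: integrableT_Z.
  by apply: eq_integral => w _; rewrite real_normK ?num_real// exprMn.
have Pfin : P [set w | (e <= `|n%:R^-1 * S n w|)%R] \is a fin_num.
  by apply: fin_num_measure; exact: measurable_abs_ge.
rewrite -(fineK Pfin) -EFinM !lee_fin => M.
have e2 : 0 < e ^+ 2 by rewrite exprn_gt0.
have {}M := M (measurable_funX 2 (@measurable_id _ _ setT)) (fun x _ => sqr_ge0 x).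
rewrite /b ler_pdivlMl// (le_trans (M _))//.
  by move=> x y x0 y0 xy; rewrite ler_sqr.
have n2 : 0 <= n%:R^-1 ^+ 2 :> R by rewrite sqr_ge0.
rewrite (le_trans (ler_wpM2l n2 ES))//.
have [->|n0] := eqVneq n 0%N; first by rewrite big_geq// !mulr0.
have n_neq0 : n%:R != 0 :> R by rewrite pnatr_eq0.
rewrite le_eqVlt; apply/orP; left; apply/eqP.
by field.
Qed.

End weak_law.

End convergence_in_probability.

(** * Correlations of fractional Gaussian noise *)

Section power_second_difference.
Context (R : realType).

Let MVT_gt0 (f df : R -> R) (a b : R) : 0 < a -> a < b ->
  (forall x : R, 0 < x -> is_derive x 1 f (df x)) ->
  exists2 c, a < c < b & f b - f a = df c * (b - a).
Proof.
move=> a0 ab dF.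
have [||c] := @MVT R f df a b ab.
- by move=> x; rewrite in_itv/= => /andP[ax _]; apply: dF; exact: lt_trans ax.
- apply: derivable_within_continuous => x; rewrite in_itv/= => /andP[ax _].
  by have [] := dF _ (lt_le_trans a0 ax).
- by rewrite in_itv/=; exists c.
Qed.

(** The second difference is F u - F (u - a) with F x = (x + a)^r - x^r. The mean value theorem for
    F, then for the power r - 1, produces r (r - 1) a^2 y^(r - 2) at some y > u - a, and this power
    is decreasing because r < 2. *)
Lemma powR_second_difference (r a u : R) : 1 < r -> r < 2 -> 0 < a -> a < u ->
  `|(u + a) `^ r + (u - a) `^ r - 2 * u `^ r| <=
  r * (r - 1) * a ^+ 2 * (u - a) `^ (r - 2).
Proof.
move=> r1 r2 a0 au.
pose F (x : R) := (x + a) `^ r - x `^ r.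
pose F' (x : R) := r * (x + a) `^ (r - 1) - r * x `^ (r - 1).
have dF (x : R) : 0 < x -> is_derive x 1 F (F' x).
  move=> x0; have xa0 : 0 < x + a by rewrite addr_gt0.
  have d1 := is_derive1_powR r x0.
  have d2 := is_derive1_powR r xa0.
  have d3 : is_derive x 1 (fun x => x + a) 1.
    by apply: is_derive_eq; rewrite addr0.
  have d4 : is_derive x 1 ((fun y : R => y `^ r) \o (fun x => x + a))
      (r * (x + a) `^ (r - 1) * 1).
    exact: is_derive1_comp.
  apply: is_derive_eq.
  by rewrite mulr1.
have ua0 : 0 < u - a by rewrite subr_gt0.
have [|x /andP[ux _] Fx] := MVT_gt0 ua0 _ dF (b := u); first by rewrite ltrBlDr ltrDl.
have x0 : 0 < x := lt_trans ua0 ux.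
have [|y /andP[xy _] Gy] := MVT_gt0 x0 _ (@is_derive1_powR R (r - 1)) (b := x + a).
  by rewrite ltrDl.
have y0 : 0 < y := lt_trans x0 xy.
have -> : (u + a) `^ r + (u - a) `^ r - 2 * u `^ r = F u - F (u - a).
  by rewrite /F subrK; ring.
rewrite Fx /F' -mulrBr Gy.
have -> : r * ((r - 1) * y `^ (r - 1 - 1) * (x + a - x)) * (u - (u - a)) =
    r * (r - 1) * a ^+ 2 * y `^ (r - 2).
  by rewrite (_ : r - 1 - 1 = r - 2); ring.
have c0 : 0 <= r * (r - 1) * a ^+ 2.
  by rewrite !mulr_ge0 ?sqr_ge0//; lra.
rewrite (ger0_norm (mulr_ge0 c0 (powR_ge0 _ _))) ler_wpM2l//.
rewrite -(opprB 2 r) !powRN lef_pV2 ?posrE ?powR_gt0//.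
by rewrite ge0_ler_powR ?nnegrE//; lra.
Qed.

(* E[(G_{(k+p)h} - G_{kh}) (G_{(k+j+p)h} - G_{(k+j)h})] for a fractional
   Brownian motion G *)
Definition noise_corr (H h : R) (p j : nat) : R :=
  2^-1 * (((j + p)%:R * h) `^ (2 * H) + `|(j%:R - p%:R) * h| `^ (2 * H)
          - 2 * (j%:R * h) `^ (2 * H)).

Lemma noise_corr_cvg0 (H h : R) (p : nat) : 2^-1 < H -> H < 1 -> 0 < h ->
  (0 < p)%N -> noise_corr H h p j @[j --> \oo] --> (0 : R).
Proof.
move=> H1 H2 h0 p0; apply/cvgr0Pnorm_le => e e0.
set r := 2 * H; set a := p%:R * h.
have a0 : 0 < a by rewrite mulr_gt0// ltr0n.
pose c := r * (r - 1) * a ^+ 2.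
have r1 : 1 < r by rewrite /r; lra.
have r2 : r < 2 by rewrite /r; lra.
have c0 : 0 < c.
  by apply: mulr_gt0; [apply: mulr_gt0; lra|exact: exprn_gt0].
(* The solution of c q^(r - 2) = e. *)
pose q : R := (e / c) `^ (- (2 - r)^-1).
have ec : 0 < e / c by rewrite divr_gt0.
have q0 : 0 < q by rewrite powR_gt0.
have decay (x : R) : q <= x -> c * x `^ (r - 2) <= e.
  move=> qx; rewrite mulrC -ler_pdivlMr//.
  have x0 : 0 < x := lt_le_trans q0 qx.
  rewrite -(opprB 2 r) powRN -[leRHS]invrK lef_pV2 ?posrE ?invr_gt0 ?powR_gt0//.
  have -> : (e / c)^-1 = q `^ (2 - r).
    rewrite /q -powRrM mulNr mulVf ?powR_inv1 ?ltW//.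
    by rewrite gt_eqF// subr_gt0.
  by apply: ge0_ler_powR; rewrite ?nnegrE// ltW// subr_gt0.
(* From this rank on j h - a >= q, the point at which the bound on the second difference is
   evaluated. *)
exists (Num.truncn ((q + a) / h)).+1 => // j /= jN.
have jh : q + a <= j%:R * h.
  rewrite -ler_pdivrMr// (le_trans (ltW (truncnS_gt _)))//.
  by rewrite ler_nat.
have aj : a < j%:R * h by lra.
rewrite /noise_corr normrM (ger0_norm (_ : 0 <= 2^-1))//.
have -> : (j + p)%:R * h = j%:R * h + a by rewrite natrD mulrDl.
have -> : `|(j%:R - p%:R) * h| = j%:R * h - a.
  by rewrite mulrBl ger0_norm// subr_ge0 ltW.
have := powR_second_difference r1 r2 a0 aj; rewrite -/c => hc.
have := decay (j%:R * h - a); rewrite lerBrDr => /(_ jh) hd.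
have := normr_ge0 ((j%:R * h + a) `^ r + (j%:R * h - a) `^ r - 2 * (j%:R * h) `^ r).
lra.
Qed.

End power_second_difference.

(** * Increments of the driving processes *)

Section increments.
Context (R : realType) (d : measure_display) (T : measurableType d)
  (P : probability T R).

Local Notation E f := (\int[P]_w f w)%R.
Local Notation intg f := (P.-integrable setT (EFin \o f)).

Definition lag_increment (h : R) (p : nat) (y : R -> T -> R) (k : nat) (w : T) : R :=
  y ((k + p)%:R * h) w - y (k%:R * h) w.

Section fractional.
Variables (H h : R) (G : R -> {RV P >-> R}) (p : nat).
Hypothesis G_fBM : fractional_Brownian_motion P H G.
Hypothesis h_gt0 : 0 < h.
Hypothesis H_gt0 : 0 < H.
Hypothesis p_gt0 : (0 < p)%N.
Local Notation g := (lag_increment h p (fun t w => G t w)).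

Let mG t : measurable_fun setT (G t) := measurable_funP (G t).

Let G_normal (t : R) : 0 <= t -> exists m v, is_normal (pushforward P (G t)) m v.
Proof.
move=> t0; have [gp _ _] := G_fBM.
have [m [v nmv]] := gp 1%N (fun=> t) (fun=> 1) (fun=> t0).
exists m, v; move: nmv; congr is_normal; congr pushforward.
by apply/funext => w; rewrite big_ord1 mul1r.
Qed.

Let G_moment4 (t : R) : 0 <= t -> finite_moment4 P (G t).
Proof. by move=> /G_normal[m [v /(is_normal_moments (mG t))[]]]. Qed.

Let EG (t : R) : 0 <= t -> E (G t) = 0.
Proof.
move=> t0; have [_ /(_ t t0) + _] := G_fBM.
by rewrite unlock /Rintegral => ->.
Qed.

Let EGG (s t : R) : 0 <= s -> 0 <= t -> E (fun w => G s w * G t w) =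
  2^-1 * (t `^ (2 * H) + s `^ (2 * H) - `|t - s| `^ (2 * H)).
Proof.
move=> s0 t0; have [_ EG0 /(_ s t s0 t0)] := G_fBM.
rewrite unlock !EG0// unlock /= /Rintegral => EGst.
rewrite -[RHS]/(fine (_ %:E)) -EGst; congr fine; apply: eq_integral => w _.
by rewrite !fctE /= !subr0.
Qed.

Lemma fBM_gaussian_moments (n : nat) (t a : 'I_n -> R) :
  (forall i, 0 <= t i) ->
  gaussian_moments P (fun w => \sum_i a i * G (t i) w).
Proof.
move=> t0; have [gp _ _] := G_fBM; have [m [v nmv]] := gp n t a t0.
apply: (is_normal_gaussian_moments _ nmv).
  by apply: measurable_sum => i; exact: measurable_funM.
have iG i : intg (fun w => a i * G (t i) w).
  by apply: integrableT_Z; apply: finite_moment4_integrable1; exact: G_moment4.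
rewrite /Rintegral.
under eq_integral do rewrite -sumEFin.
rewrite integral_sum//.
rewrite big1// => i _.
rewrite -[X in X = _]fineK; last exact: (integrable_fin_num measurableT (iG i)).
rewrite -/(Rintegral P setT (fun w => a i * G (t i) w)) RintegralT_Z ?EG ?mulr0//.
by apply: finite_moment4_integrable1; exact: G_moment4.
Qed.

Let grid k : 0 <= k%:R * h. Proof. by rewrite mulr_ge0// ltW. Qed.

(** Two increments are read off four values of the process, at times that may coincide or come in
    any order, as [gaussian_process] allows. The cases x = 1, y = 1 or -1 feed the polarization. *)
Lemma fBM_increment_gaussian k l (x y : R) :
  gaussian_moments P (fun w => x * g k w + y * g l w).
Proof.
pose t := [:: (k + p)%:R * h; k%:R * h; (l + p)%:R * h; l%:R * h].
pose a := [:: x; - x; y; - y].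
have := @fBM_gaussian_moments 4 (fun i => t`_i) (fun i => a`_i).
rewrite (_ : (fun w => _) = (fun w => x * g k w + y * g l w)).
  by apply=> -[[|[|[|[|]]]]]//= _; exact: grid.
apply/funext => w; rewrite !big_ord_recr big_ord0/= /lag_increment.
by ring.
Qed.

Lemma fBM_increment_gaussian1 k : gaussian_moments P (g k).
Proof.
have := fBM_increment_gaussian k k 1 0.
by congr gaussian_moments; apply/funext => w; ring.
Qed.

Lemma fBM_increment_moment4 k : finite_moment4 P (g k).
Proof. by have [] := fBM_increment_gaussian1 k. Qed.

(** In the four covariances the powers of single times cancel and only differences of times remain;
    this is why k disappears. *)
Lemma fBM_increment_corr k j :
  E (fun w => g k w * g (k + j)%N w) = noise_corr H h p j.
Proof.
have iGG s t : 0 <= s -> 0 <= t -> intg (fun w => G s w * G t w).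
  by move=> s0 t0; apply: finite_moment4_integrable2; exact: G_moment4.
pose t0 := (k + p)%:R * h; pose t1 := k%:R * h.
pose t2 := (k + j + p)%:R * h; pose t3 := (k + j)%:R * h.
have -> : E (fun w => g k w * g (k + j)%N w) =
    (E (fun w => G t0 w * G t2 w) + - 1 * E (fun w => G t0 w * G t3 w)) +
    (- 1 * E (fun w => G t1 w * G t2 w) + E (fun w => G t1 w * G t3 w)).
  have i1 := iGG _ _ (grid (k + p)) (grid (k + j + p)).
  have i2 := integrableT_Z (- 1) (iGG _ _ (grid (k + p)) (grid (k + j))).
  have i3 := integrableT_Z (- 1) (iGG _ _ (grid k) (grid (k + j + p))).
  have i4 := iGG _ _ (grid k) (grid (k + j)).
  have i12 := integrableT_D i1 i2; have i34 := integrableT_D i3 i4.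
  have i2' := iGG _ _ (grid (k + p)) (grid (k + j)).
  have i3' := iGG _ _ (grid k) (grid (k + j + p)).
  rewrite -!RintegralT_Z// -!RintegralT_D//.
  by apply: eq_Rintegral => w _; rewrite /lag_increment; ring.
rewrite !EGG; [|exact: grid..].
rewrite /noise_corr /t0 /t1 /t2 /t3 -!mulrBl.
rewrite (_ : (k + j + p)%:R - (k + p)%:R = j%:R); last by rewrite !natrD; ring.
rewrite (_ : (k + j)%:R - (k + p)%:R = j%:R - p%:R); last by rewrite !natrD; ring.
rewrite (_ : (k + j + p)%:R - k%:R = (j + p)%:R); last by rewrite !natrD; ring.
rewrite (_ : (k + j)%:R - k%:R = j%:R); last by rewrite !natrD; ring.
rewrite !(ger0_norm (grid _)).
by field.
Qed.

Lemma fBM_increment_sqr k : E (fun w => g k w ^+ 2) = (p%:R * h) `^ (2 * H).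
Proof.
have := fBM_increment_corr k 0; rewrite addn0 => E2.
rewrite E2 /noise_corr add0n sub0r mulNr normrN (ger0_norm (grid _)) mul0r.
by rewrite powR0 ?gt_eqF ?mulr_gt0//; field.
Qed.

(** The offset s serves the second factors in the eta and zeta statistics, whose increments start at
    k + 1 and k + 2. *)
Lemma fBM_weak_law s : noise_corr H h p j @[j --> \oo] --> (0 : R) ->
  cvg_prob0 P (fun n w => n%:R^-1 * \sum_(0 <= k < n) g (k + s)%N w).
Proof.
move=> rho0.
apply: (@weak_law _ _ _ _ (fun k => g (k + s)%N) (fun j => `|noise_corr H h p j|)).
- by move=> k; have [] := fBM_increment_moment4 (k + s).
- by move=> k l; apply: finite_moment4_integrable2; exact: fBM_increment_moment4.
- by move=> k j; rewrite -addnA (addnC j) addnA fBM_increment_corr.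
- by rewrite -(normr0 R); exact: (cvg_norm rho0).
Qed.

Lemma fBM_sqr_weak_law s : noise_corr H h p j @[j --> \oo] --> (0 : R) ->
  cvg_prob0 P (fun n w => n%:R^-1 *
    \sum_(0 <= k < n) (g (k + s)%N w ^+ 2 - (p%:R * h) `^ (2 * H))).
Proof.
move=> rho0; set v := (p%:R * h) `^ (2 * H).
have f4 := fBM_increment_moment4.
have i22 k l : intg (fun w => g k w ^+ 2 * g l w ^+ 2).
  have := finite_moment4_integrable (f4 k) (f4 k) (f4 l) (f4 l).
  by congr (_.-integrable _ _); apply/funext => w /=; congr EFin; ring.
have i2 k := finite_moment4_sqr_integrable (f4 k).
have icst c : intg (fun=> c : R) by exact: finite_measure_integrable_cst.
have iv k : intg (fun w => - v * g k w ^+ 2) by exact: integrableT_Z.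
have ivv k := integrableT_D (iv k) (icst (v ^+ 2)).
have ivvv k l := integrableT_D (iv k) (ivv l).
have expand k l : (fun w => (g k w ^+ 2 - v) * (g l w ^+ 2 - v)) =
    (fun w => g k w ^+ 2 * g l w ^+ 2 +
      (- v * g k w ^+ 2 + (- v * g l w ^+ 2 + v ^+ 2))).
  by apply/funext => w; ring.
apply: (@weak_law _ _ _ _ (fun k w => g (k + s)%N w ^+ 2 - v)
    (fun j => 2 * noise_corr H h p j ^+ 2)).
- move=> k; apply: measurable_funB => //; apply: measurable_funX.
  by have [] := f4 (k + s)%N.
- by move=> k l; rewrite expand; exact: integrableT_D.
- move=> k j; rewrite -addnA (addnC j) addnA.
  set k' := (k + s)%N.
  rewrite expand !RintegralT_D// !RintegralT_Z// RintegralT_cst.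
  rewrite gaussian_moments_sqr_sqr; last 4 first.
  + exact: fBM_increment_gaussian1.
  + exact: fBM_increment_gaussian1.
  + have := fBM_increment_gaussian k' (k' + j) 1 1.
    by congr gaussian_moments; apply/funext => w; ring.
  + have := fBM_increment_gaussian k' (k' + j) 1 (-1).
    by congr gaussian_moments; apply/funext => w; ring.
  rewrite !fBM_increment_sqr fBM_increment_corr -/v.
  rewrite (_ : _ + _ = 2 * noise_corr H h p j ^+ 2); last by ring.
  by rewrite ger0_norm// mulr_ge0// sqr_ge0.
have -> : (0 : R) = 2 * (0 * 0) by rewrite !mulr0.
by apply: cvgM; [exact: cvg_cst|exact: cvgM].
Qed.

End fractional.

End increments.

Section independence.
Context (R : realType) (d : measure_display) (T : measurableType d)
  (P : probability T R).

Lemma mutually_independent_pair (I : choiceType) (F : I -> set (set T)) i j :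
  mutually_independent P F -> i != j -> independent2 P (F i) (F j).
Proof.
move=> indep ij A B FA FB.
have := indep [fset i; j]%fset (fun k => if k == i then A else B).
rewrite big_fsetU1 ?inE//= big_seq_fset1 eqxx eq_sym (negbTE ij).
have -> : \bigcap_(k in [set` [fset i; j]%fset]) (if k == i then A else B) = A `&` B.
  apply/seteqP; split => w.
    move=> AB; split.
      by have := AB i; rewrite /= !inE eqxx; apply.
    by have := AB j; rewrite /= !inE eqxx orbT eq_sym (negbTE ij); apply.
  by move=> [Aw Bw] k /=; rewrite !inE => /orP[/eqP ->|/eqP ->];
    rewrite ?eqxx// eq_sym (negbTE ij).
apply => k; rewrite !inE => /orP[/eqP ->|/eqP ->]; first by rewrite eqxx.
by rewrite eq_sym (negbTE ij).
Qed.

Lemma independent2S (F F' G G' : set (set T)) : F' `<=` F -> G' `<=` G ->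
  independent2 P F G -> independent2 P F' G'.
Proof. by move=> FF GG indep A B /FF FA /GG GB; exact: indep. Qed.

Lemma preimage_comp_sub (X : T -> R) (f : R -> R) : measurable_fun setT f ->
  g_sigma_algebra_preimage (f \o X) `<=` g_sigma_algebra_preimage X.
Proof.
move=> mf _ [A mA <-]; exists (f @^-1` A); last by rewrite !setTI comp_preimage.
by rewrite -[X in measurable X]setTI; exact: mf.
Qed.

(** With T equipped with the sigma-algebra generated by the process at nonnegative times, the
    inclusion is the measurability of a product of differences. *)
Lemma increment_mul_sigma_process (h : R) p (X : R -> T -> R) k l : 0 < h ->
  g_sigma_algebra_preimage
    (fun w => lag_increment h p X k w * lag_increment h p X l w)
  `<=` sigma_process X.
Proof.
move=> h0.
pose S := g_sigma_algebraType
  (\bigcup_(t in [set t : R | 0 <= t]) g_sigma_algebra_preimage (X t)).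
have mX n : measurable_fun [set: S] (X (n%:R * h) : S -> R).
  move=> _ A mA; apply: sub_sigma_algebra.
  exists (n%:R * h) => /=; first by rewrite mulr_ge0// ltW.
  by exists A.
move=> _ [A mA <-].
have mm : measurable_fun [set: S]
    (fun w : S => lag_increment h p X k w * lag_increment h p X l w).
  by apply: measurable_funM; apply: measurable_funB; exact: mX.
exact: (mm measurableT A mA).
Qed.

End independence.

(** * Brownian increments and their products with fractional ones *)

Section brownian_increments.
Context (R : realType) (d : measure_display) (T : measurableType d)
  (P : probability T R).

Local Notation E f := (\int[P]_w f w)%R.
Local Notation intg f := (P.-integrable setT (EFin \o f)).

(** Cruder than Cauchy-Schwarz, but it is applied only to the finitely many lags at which Brownian
    increments overlap. *)
Lemma normr_RintegralM_le (X Y : T -> R) :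
  intg (fun w => X w ^+ 2) -> intg (fun w => Y w ^+ 2) ->
  intg (fun w => X w * Y w) ->
  `|E (fun w => X w * Y w)| <= E (fun w => X w ^+ 2) + E (fun w => Y w ^+ 2).
Proof.
move=> iX iY iXY; rewrite -RintegralT_D//.
rewrite (le_trans (le_normr_Rintegral measurableT iXY))//.
apply: le_Rintegral => //.
- have := integrable_abse iXY; by congr (_.-integrable _ _).
- exact: integrableT_D.
move=> w _; have := sqr_ge0 (X w - Y w); have := sqr_ge0 (X w + Y w).
have := sqr_ge0 (X w); have := sqr_ge0 (Y w).
by rewrite !expr2 => *; apply/ler_normlP; split; lra.
Qed.

Lemma cvg_if_lt (p : nat) (c : R) :
  (if (j < p)%N then c else 0) @[j --> \oo] --> (0 : R).
Proof.
by apply: cvg_near_cst; exists p => // j /=; rewrite leqNgt => /negbTE ->.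
Qed.

Section fixed_lag.
Variables (h : R) (W : R -> {RV P >-> R}) (p : nat).
Hypothesis W_BM : standard_Brownian_motion P W.
Hypothesis h_gt0 : 0 < h.
Local Notation b := (lag_increment h p (fun t w => W t w)).
Local Notation v := (p%:R * h).

Let grid k : 0 <= k%:R * h. Proof. by rewrite mulr_ge0// ltW. Qed.

Let grid_le k l : (k <= l)%N -> k%:R * h <= l%:R * h.
Proof. by move=> kl; rewrite (ler_wpM2r (ltW h_gt0))// ler_nat. Qed.

Lemma BM_increment_moments k : [/\ finite_moment4 P (b k), E (b k) = 0,
  E (fun w => b k w ^+ 2) = v & E (fun w => b k w ^+ 4) = 3 * v ^+ 2].
Proof.
have [_ _ /(_ _ _ (grid k) (grid_le (leq_addr p k))) law _] := W_BM.
have mb : measurable_fun setT (b k).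
  by apply: measurable_funB; exact: measurable_funP.
have [f4 E1 E2 E4] := is_normal_moments mb law.
split => //.
  move: E2; under eq_Rintegral do rewrite subr0.
  by move=> ->; rewrite natrD; ring.
move: E4; under eq_Rintegral do rewrite subr0.
by move=> ->; rewrite natrD; ring.
Qed.

Lemma BM_increment_moment4 k : finite_moment4 P (b k).
Proof. by have [] := BM_increment_moments k. Qed.

Lemma BM_increment_indep k j : (p <= j)%N ->
  independent2 P (g_sigma_algebra_preimage (b k))
                 (g_sigma_algebra_preimage (b (k + j)%N)).
Proof.
move=> pj; have [_ + _ _] := W_BM.
(* The definition of Brownian motion takes an infinite nondecreasing sequence of times: k, k + p, k
   + j, then k + j + p forever (in units of h). The two increments are numbers 0 and 2, and p <= j
   gives the order. *)
pose t i := (nth (k + j + p)%N [:: k; k + p; k + j]%N i)%:R * h.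
move=> /(_ t (grid _)) indep.
have {}indep := indep _.
apply: (mutually_independent_pair (i := 0%N) (j := 2%N) (indep _)) => //.
move=> [|[|[|i]]]; apply: grid_le => /=; rewrite ?nth_nil ?leq_addr//.
by rewrite leq_add2l.
Qed.

Lemma BM_increment_corr k j : (p <= j)%N -> E (fun w => b k w * b (k + j)%N w) = 0.
Proof.
move=> pj; rewrite independent2_expectationM.
- by have [_ -> _ _] := BM_increment_moments k; rewrite mul0r.
- by have [] := BM_increment_moment4 k.
- by have [] := BM_increment_moment4 (k + j).
- exact: finite_moment4_integrable1 (BM_increment_moment4 _).
- exact: finite_moment4_integrable1 (BM_increment_moment4 _).
- by apply: finite_moment4_integrable2; exact: BM_increment_moment4.
- exact: BM_increment_indep.
Qed.

(** Increments over disjoint intervals are uncorrelated, so the correlation bound vanishes from lag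
    p on; the p lags with overlap carry the crude bound. *)
Lemma BM_weak_law s :
  cvg_prob0 P (fun n w => n%:R^-1 * \sum_(0 <= k < n) b (k + s)%N w).
Proof.
have i2 k l : intg (fun w => b k w * b l w).
  by apply: finite_moment4_integrable2; exact: BM_increment_moment4.
apply: (@weak_law _ _ _ _ (fun k => b (k + s)%N)
    (fun j => if (j < p)%N then v + v else 0)) => //.
- by move=> k; have [] := BM_increment_moment4 (k + s).
- move=> k j; rewrite -addnA (addnC j) addnA; set k' := (k + s)%N.
  case: ltnP => jp; last by rewrite BM_increment_corr// normr0.
  have [f1 _ E1 _] := BM_increment_moments k'.
  have [f2 _ E2 _] := BM_increment_moments (k' + j).
  by rewrite (le_trans (normr_RintegralM_le _ _ _)) ?E1 ?E2//;
    exact: finite_moment4_sqr_integrable.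
- exact: cvg_if_lt.
Qed.

Lemma BM_sqr_weak_law s : cvg_prob0 P (fun n w => n%:R^-1 *
  \sum_(0 <= k < n) (b (k + s)%N w ^+ 2 - v)).
Proof.
have f4 := BM_increment_moment4.
have i22 k l : intg (fun w => b k w ^+ 2 * b l w ^+ 2).
  have := finite_moment4_integrable (f4 k) (f4 k) (f4 l) (f4 l).
  by congr (_.-integrable _ _); apply/funext => w /=; congr EFin; ring.
have i2 k := finite_moment4_sqr_integrable (f4 k).
have icst c : intg (fun=> c : R) by exact: finite_measure_integrable_cst.
have iv k : intg (fun w => - v * b k w ^+ 2) by exact: integrableT_Z.
have ivv k := integrableT_D (iv k) (icst (v ^+ 2)).
have ivvv k l := integrableT_D (iv k) (ivv l).
have expand k l : (fun w => (b k w ^+ 2 - v) * (b l w ^+ 2 - v)) =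
    (fun w => b k w ^+ 2 * b l w ^+ 2 +
      (- v * b k w ^+ 2 + (- v * b l w ^+ 2 + v ^+ 2))).
  by apply/funext => w; ring.
have iZZ k l : intg (fun w => (b k w ^+ 2 - v) * (b l w ^+ 2 - v)).
  by rewrite expand; exact: integrableT_D.
have EZ k : E (fun w => b k w ^+ 2 - v) = 0.
  rewrite RintegralT_D// RintegralT_cst.
  by have [_ _ -> _] := BM_increment_moments k; rewrite subrr.
have iZ k : intg (fun w => b k w ^+ 2 - v) by exact: integrableT_D.
have EZ2 k : E (fun w => (b k w ^+ 2 - v) ^+ 2) = 2 * v ^+ 2.
  have -> : (fun w => (b k w ^+ 2 - v) ^+ 2) =
      (fun w => b k w ^+ 4 + (- (2 * v) * b k w ^+ 2 + v ^+ 2)).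
    by apply/funext => w; ring.
  have [_ _ E2 E4] := BM_increment_moments k.
  have i4 := (f4 k).2; have i2' := integrableT_Z (- (2 * v)) (i2 k).
  have i2'' := integrableT_D i2' (icst (v ^+ 2)).
  by rewrite !RintegralT_D// RintegralT_Z// RintegralT_cst E2 E4; ring.
have mZ k : measurable_fun setT (fun w => b k w ^+ 2 - v).
  by apply: measurable_funB => //; apply: measurable_funX; have [] := f4 k.
have msq : measurable_fun setT (fun x : R => x ^+ 2 - v).
  by apply: measurable_funB => //; exact: measurable_funX.
apply: (@weak_law _ _ _ _ (fun k w => b (k + s)%N w ^+ 2 - v)
    (fun j => if (j < p)%N then 2 * v ^+ 2 + 2 * v ^+ 2 else 0)) => //.
- move=> k j; rewrite -addnA (addnC j) addnA; set k' := (k + s)%N.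
  case: ltnP => jp.
    rewrite (le_trans (normr_RintegralM_le _ _ _)) ?EZ2//.
      by have := iZZ k' k'.
    by have := iZZ (k' + j)%N (k' + j)%N.
  rewrite independent2_expectationM// ?EZ ?mul0r ?normr0//.
  apply: independent2S (BM_increment_indep jp).
    exact: (preimage_comp_sub (X := b k') msq).
  exact: (preimage_comp_sub (X := b (k' + j)%N) msq).
- exact: cvg_if_lt.
Qed.

Variables (H : R) (G : R -> {RV P >-> R}).
Hypothesis G_fBM : fractional_Brownian_motion P H G.
Hypothesis H_gt0 : 0 < H.
Hypothesis p_gt0 : (0 < p)%N.
Hypothesis WG_indep : independent2 P (sigma_process (fun t w => W t w))
  (sigma_process (fun t w => G t w)).
Local Notation g := (lag_increment h p (fun t w => G t w)).

(** By independence of the two processes the covariance is the product of the Brownian and the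
    fractional ones, and the Brownian factor is 0 from lag p on. *)
Lemma mixed_weak_law s : cvg_prob0 P (fun n w => n%:R^-1 *
  \sum_(0 <= k < n) (b (k + s)%N w * g (k + s)%N w)).
Proof.
have f4 := BM_increment_moment4.
have g4 := fBM_increment_moment4 p G_fBM h_gt0.
have i4 k l : intg (fun w => (b k w * b l w) * (g k w * g l w)).
  have := finite_moment4_integrable (f4 k) (f4 l) (g4 k) (g4 l).
  by congr (_.-integrable _ _); apply/funext => w /=; congr EFin; ring.
have ib k l : intg (fun w => b k w * b l w) by exact: finite_moment4_integrable2.
have ig k l : intg (fun w => g k w * g l w) by exact: finite_moment4_integrable2.
have expand k l : (fun w => (b k w * g k w) * (b l w * g l w)) =
    (fun w => (b k w * b l w) * (g k w * g l w)).
  by apply/funext => w; ring.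
have mb k : measurable_fun setT (b k) by have [] := f4 k.
have mg k : measurable_fun setT (g k) by have [] := g4 k.
have EM k l : E (fun w => (b k w * g k w) * (b l w * g l w)) =
    E (fun w => b k w * b l w) * E (fun w => g k w * g l w).
  rewrite expand independent2_expectationM//; try exact: measurable_funM.
  apply: independent2S WG_indep.
    exact: (increment_mul_sigma_process (X := fun t w => W t w)).
  exact: (increment_mul_sigma_process (X := fun t w => G t w)).
pose c := v * (p%:R * h) `^ (2 * H).
apply: (@weak_law _ _ _ _ (fun k w => b (k + s)%N w * g (k + s)%N w)
    (fun j => if (j < p)%N then c + c else 0)) => //.
- by move=> k; exact: measurable_funM.
- by move=> k l; rewrite expand.
- move=> k j; rewrite -addnA (addnC j) addnA; set k' := (k + s)%N.
  case: ltnP => jp; last by rewrite EM BM_increment_corr// mul0r normr0.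
  have E2 l : E (fun w => (b l w * g l w) ^+ 2) = c.
    transitivity (E (fun w => b l w ^+ 2) * E (fun w => g l w ^+ 2)); first exact: EM.
    have [_ _ -> _] := BM_increment_moments l.
    by rewrite (fBM_increment_sqr p G_fBM h_gt0 H_gt0).
  have i2 l : intg (fun w => (b l w * g l w) ^+ 2) by have := i4 l l; rewrite -expand.
  rewrite (le_trans (normr_RintegralM_le _ _ _)) ?E2//.
  by rewrite expand.
- exact: cvg_if_lt.
Qed.

End fixed_lag.

End brownian_increments.

(** * Differential of the estimator *)

Section estimator_differential.
Context (R : realType).

(** The bridge between [is_derive], used for inverse, logarithm and powers of one variable, and
    [is_diff], used on row vectors. *)
Lemma is_diff_derive_comp (V : normedModType R) (f : R -> R) (df : R)
    (k dk : V -> R) (x : V) :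
  is_derive (k x) 1 f df -> is_diff x k dk ->
  is_diff x (f \o k) (fun v => df * dk v).
Proof.
move=> fd kd; have [fder fval] := fd.
have dff : differentiable f (k x) by apply/derivable1_diffP.
have fdiff : is_diff (k x) f (fun t => df * t).
  apply: DiffDef => //; rewrite diff1E//; apply/funext => t.
  by rewrite derive1E fval /GRing.scale/= mulrC.
exact: (is_diff_comp kd fdiff).
Qed.

Lemma is_diff_coord n (u : 'rV[R]_n) (j : 'I_n) :
  is_diff u (fun v : 'rV[R]_n => v 0 j : R) (fun v => v 0 j).
Proof.
have @f : {linear 'rV[R]_n -> R}.
  by exists (fun N : 'rV[R]_n => N 0 j); do 2![eexists]; do ?[constructor];
     rewrite ?mxE// => ? *; rewrite ?mxE//; move=> ?; rewrite !mxE.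
apply: DiffDef; first exact: differentiable_coord.
rewrite (_ : (fun _ => _) = f) //.
by rewrite diff_lin//; exact: coord_continuous.
Qed.

Lemma is_diff_row_seq3 (V : normedModType R) (f0 f1 f2 d0 d1 d2 : V -> R) (x : V) :
  is_diff x f0 d0 -> is_diff x f1 d1 -> is_diff x f2 d2 ->
  is_diff x (fun v => row_seq 3 [:: f0 v; f1 v; f2 v])
            (fun v => row_seq 3 [:: d0 v; d1 v; d2 v]).
Proof.
pose e i : 'rV[R]_3 := delta_mx 0 i.
have row3 (a b c : R) : row_seq 3 [:: a; b; c] = a *: e 0 + b *: e 1 + c *: e 2.
  apply/rowP => i; rewrite !mxE !eqxx /=.
  by case: i => [[|[|[|]]]]//= ?; rewrite !(mulr0, mulr1, addr0, add0r).
move=> i0 i1 i2.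
have -> : (fun v => row_seq 3 [:: f0 v; f1 v; f2 v]) =
    ((fun a => a *: e 0) \o f0) + ((fun a => a *: e 1) \o f1) + ((fun a => a *: e 2) \o f2).
  by apply/funext => v; rewrite row3.
apply: is_diff_eq.
by apply/funext => v; rewrite row3.
Qed.

Lemma is_derive_log2_plus (x : R) : 0 < x ->
  is_derive x 1 (@log2_plus R) (x * ln 2)^-1.
Proof.
move=> x0; have dln := is_derive1_ln x0.
have d1 : is_derive x 1 (fun y => ln y * (ln 2)^-1) (x * ln 2)^-1.
  by apply: is_derive_eq; rewrite /GRing.scale/= invfM; ring.
apply: near_eq_is_derive d1 => //.
by near=> y; rewrite /log2_plus ifT//; near: y; exact: lt_nbhsr.
Unshelve. all: by end_near. Qed.

Lemma is_derive_powRr (a x : R) : 0 < a ->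
  is_derive x 1 (fun y => a `^ (2 * y)) (2 * ln a * a `^ (2 * x)).
Proof.
move=> a0.
have powE y : a `^ (2 * y) = expR (2 * ln a * y).
  by rewrite /powR gt_eqF//; congr expR; ring.
rewrite (_ : (fun y => a `^ (2 * y)) = expR \o (fun y => 2 * ln a * y)); last first.
  by apply/funext => y; rewrite powE.
rewrite powE.
have d1 : is_derive x 1 (fun y : R => 2 * ln a * y) (2 * ln a).
  by apply: is_derive_eq; rewrite /GRing.scale/=; ring.
by rewrite [_ * expR _]mulrC; exact: is_derive1_comp (is_derive_expR _) d1.
Qed.

Lemma powR2_sub1 (x : R) : 2 `^ (2 * x - 1) = 2 `^ (2 * x) / 2 :> R.
Proof. by rewrite powRB ?powRr1// pnatr_eq0 implybT. Qed.

Lemma is_derive_D_ (h x : R) : 0 < h -> is_derive x 1 (D_ h) (D'_ h x).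
Proof.
move=> h0; have d1 := is_derive_powRr x h0.
have d2 : is_derive x 1 (fun y : R => 2 `^ (2 * y)) (2 * ln 2 * 2 `^ (2 * x)).
  exact: is_derive_powRr.
have -> : D_ h = (fun y => h `^ (2 * y)) * (fun y => 2 `^ (2 * y) * 2^-1 - 1).
  by apply/funext => y; rewrite /D_ powR2_sub1.
have d3 : is_derive x 1 (fun y : R => 2 `^ (2 * y) * 2^-1 - 1) (ln 2 * 2 `^ (2 * x)).
  by apply: is_derive_eq; rewrite /GRing.scale/=; field.
apply: is_derive_eq.
by rewrite /D'_ powR2_sub1 /GRing.scale/=; field.
Qed.

End estimator_differential.

Section estimator_jacobian.
Context (R : realType).
Variables (h H sigma gamma V : R).
Hypothesis h_gt0 : 0 < h.
Hypothesis H_gt : 2^-1 < H.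
Hypothesis gamma_gt0 : 0 < gamma.

Local Notation U := (U_infty h H sigma gamma V).
Local Notation B := (gamma ^+ 2 * h `^ (2 * H) * (2 `^ (2 * H - 1) - 1)).
Local Notation p := (2 `^ (2 * H)).

Lemma powR2_gt1 : 0 < 2 `^ (2 * H - 1) - 1 :> R.
Proof.
rewrite subr_gt0 -[ltLHS](powRr0 2) /powR pnatr_eq0/= ltr_expR mul0r.
by rewrite mulr_gt0 ?ln_gt0 ?ltr1n//; move: H_gt; lra.
Qed.

Lemma D_gt0 : 0 < D_ h H.
Proof. by rewrite mulr_gt0 ?powR_gt0// powR2_gt1. Qed.

Lemma B_gt0 : 0 < B.
Proof. by rewrite !mulr_gt0 ?powR_gt0 ?exprn_gt0// powR2_gt1. Qed.

Lemma log2_plus_powR2 : log2_plus p = 2 * H :> R.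
Proof.
rewrite /log2_plus powR_gt0// ln_powR mulfK// gt_eqF// ln_gt0// ltr1n//.
Qed.

(** The three combinations through which the estimator factors; being linear, each is its own
    differential. *)
Let ca (u : 'rV[R]_4) : R := u 0 1 - h ^+ 2 * u 0 0.
Let cb (u : 'rV[R]_4) : R := u 0 2 - h ^+ 2 * u 0 0.
Let cc (u : 'rV[R]_4) : R := u 0 3 - 4 * h ^+ 2 * u 0 0.

Lemma U_inftyE : [/\ ca U = sigma ^+ 2 * h + gamma ^+ 2 * h `^ (2 * H),
  cb U = B & cc U = p * B].
Proof. by rewrite /ca /cb /cc !mxE /= /eta_infty; split; ring. Qed.

Let coordB (j : 'I_4) (c : R) (u : 'rV[R]_4) :
  is_diff u (fun v : 'rV[R]_4 => v 0 j - c * v 0 0)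
            (fun v => v 0 j - c * v 0 0).
Proof.
have d0 := is_diff_coord u 0; have dj := is_diff_coord u j.
have -> : (fun v : 'rV[R]_4 => v 0 j - c * v 0 0) =
  (fun v : 'rV[R]_4 => v 0 j : R) - c *: (fun v : 'rV[R]_4 => v 0 0 : R) by [].
exact: is_diff_eq.
Qed.

Let Hh (u : 'rV[R]_4) := H_hat h (u 0 0) (u 0 1) (u 0 2) (u 0 3).
Let gh (u : 'rV[R]_4) := gamma2_hat h (u 0 0) (u 0 1) (u 0 2) (u 0 3).
Let sh (u : 'rV[R]_4) := sigma2_hat h (u 0 0) (u 0 1) (u 0 2) (u 0 3).

Let HhU : Hh U = H.
Proof.
have [_ Eb Ec] := U_inftyE; rewrite /Hh /H_hat -/(cb U) -/(cc U) Eb Ec.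
by rewrite mulfK ?gt_eqF ?B_gt0// log2_plus_powR2; field.
Qed.

(** The chain rule for the three estimators, each differential expressed by the previous ones: [dg]
    is that of [cb] / [D_] at B = gamma^2 D, and [ds] contains the product rule for gamma2_hat h^(2
    H_hat). *)
Let dH (v : 'rV[R]_4) : R := (2 * ln 2)^-1 * (cc v / (p * B) - cb v / B).
Let dg (v : 'rV[R]_4) : R := cb v / D_ h H - gamma ^+ 2 * D'_ h H / D_ h H * dH v.
Let ds (v : 'rV[R]_4) : R := (ca v - (gamma ^+ 2 * (2 * ln h * h `^ (2 * H) * dH v)
   + h `^ (2 * H) * dg v)) / h.

Let ln2_neq0 : ln 2 != 0 :> R.
Proof. by rewrite gt_eqF// ln_gt0// ltr1n. Qed.

Let h_neq0 : h != 0. Proof. by rewrite gt_eqF. Qed.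

Let gamma_neq0 : gamma != 0. Proof. by rewrite gt_eqF. Qed.

Let p_neq0 : p != 0 :> R. Proof. by rewrite gt_eqF// powR_gt0. Qed.

Let q_neq0 : h `^ (2 * H) != 0. Proof. by rewrite gt_eqF// powR_gt0. Qed.

Let r_neq0 : 2 `^ (2 * H - 1) - 1 != 0 :> R.
Proof. by rewrite gt_eqF// powR2_gt1. Qed.

Let D_neq0 : D_ h H != 0. Proof. by rewrite gt_eqF// D_gt0. Qed.

Lemma is_diff_H_hat : is_diff U Hh dH.
Proof.
have [_ Eb Ec] := U_inftyE.
have db : is_diff U cb cb by exact: coordB.
have dc : is_diff U cc cc by exact: coordB.
have B0 := B_gt0; have p0 : 0 < p :> R by exact: powR_gt0.
have B_neq0 : B != 0 by rewrite gt_eqF.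
have dinv : is_derive (cb U) 1 (fun x : R => x^-1) (- B ^- 2).
  have := @is_deriveV R id (cb U) 1 1; rewrite Eb /= => /(_ B_neq0 (is_derive_id _ _)).
  by rewrite /GRing.scale/= mulr1.
have di := is_diff_derive_comp dinv db.
have dq : is_diff U (cc * ((fun x => x^-1) \o cb))
    (cc U *: (fun v => - B ^- 2 * cb v) + ((fun x => x^-1) \o cb) U *: cc).
  exact: is_diffM.
have quoU : (cc * ((fun x => x^-1) \o cb)) U = p.
  by rewrite !fctE /= Eb Ec mulfK.
have dl : is_derive ((cc * ((fun x => x^-1) \o cb)) U) 1 (@log2_plus R) (p * ln 2)^-1.
  by rewrite quoU; exact: is_derive_log2_plus.
have dlq := is_diff_derive_comp dl dq.
have -> : Hh = 2^-1 *: (@log2_plus R \o (cc * ((fun x => x^-1) \o cb))) by [].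
apply: is_diff_eq; apply/funext => v.
rewrite !fctE /= /dH Eb Ec /GRing.scale/=.
by field; rewrite r_neq0 q_neq0 gamma_neq0 p_neq0 ln2_neq0.
Qed.

Lemma is_diff_gamma2_hat : is_diff U gh dg.
Proof.
have [_ Eb _] := U_inftyE.
have db : is_diff U cb cb by exact: coordB.
have dHh := is_diff_H_hat.
have dD : is_derive (Hh U) 1 (fun x => (D_ h x)^-1) (- (D_ h H) ^- 2 * D'_ h H).
  rewrite HhU; exact: is_deriveV D_neq0 (is_derive_D_ H h_gt0).
have dDH := is_diff_derive_comp dD dHh.
have -> : gh = cb * ((fun x => (D_ h x)^-1) \o Hh) by [].
apply: is_diff_eq; apply/funext => v.
rewrite !fctE /= /dg HhU Eb /GRing.scale/=.
have -> : B = gamma ^+ 2 * D_ h H by rewrite /D_ mulrA.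
by field.
Qed.

Let ghU : gh U = gamma ^+ 2.
Proof.
have [_ Eb _] := U_inftyE.
rewrite /gh /gamma2_hat -/(Hh U) HhU -/(cb U) Eb -/(D_ h H).
by rewrite (_ : B = gamma ^+ 2 * D_ h H) ?mulfK// /D_ mulrA.
Qed.

Lemma Theta_hat_U_infty :
  Theta_hat h U = row_seq 3 [:: H; gamma ^+ 2; sigma ^+ 2].
Proof.
have [Ea _ _] := U_inftyE.
rewrite /Theta_hat -/(Hh U) -/(gh U) -/(sh U) HhU ghU; congr (row_seq 3 [:: _; _; _]).
rewrite /sh /sigma2_hat -/(Hh U) -/(gh U) HhU ghU -/(ca U) Ea.
by field.
Qed.

Lemma is_diff_sigma2_hat : is_diff U sh ds.
Proof.
have [_ Eb _] := U_inftyE.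
have da : is_diff U ca ca by exact: coordB.
have dHh := is_diff_H_hat.
have dgh := is_diff_gamma2_hat.
have dE : is_derive (Hh U) 1 (fun x => h `^ (2 * x)) (2 * ln h * h `^ (2 * H)).
  by rewrite HhU; exact: is_derive_powRr.
have dEH := is_diff_derive_comp dE dHh.
have -> : sh = h^-1 *: (ca - gh * ((fun x => h `^ (2 * x)) \o Hh)).
  by apply/funext => u; rewrite !fctE /GRing.scale/= mulrC.
apply: is_diff_eq; apply/funext => v.
by rewrite !fctE /= /ds HhU ghU /GRing.scale/= mulrC.
Qed.

Lemma is_diff_Theta_hat : is_diff U (Theta_hat h)
  (fun v => row_seq 3 [:: dH v; dg v; ds v]).
Proof.
exact: is_diff_row_seq3 is_diff_H_hat is_diff_gamma2_hat is_diff_sigma2_hat.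
Qed.

Lemma differentiable_Theta_hat : differentiable (Theta_hat h) U.
Proof. by have [] := is_diff_Theta_hat. Qed.

Lemma jacobian_Theta_hat : (jacobian (Theta_hat h) U)^T = J_entries h H gamma B.
Proof.
have [_ dE] := is_diff_Theta_hat.
apply/matrixP => i j; rewrite !mxE dE !mxE.
have BE : B = gamma ^+ 2 * D_ h H by rewrite /D_ mulrA.
have qE : h `^ (2 * H - 1) = h `^ (2 * H) / h.
  by rewrite powRB ?powRr1 ?ltW// h_neq0 implybT.
rewrite /ds /dg /dH BE qE powRN /ca /cb /cc !mxE !eqxx /=.
(* All entries are rational in these four quantities, h, gamma, ln h and ln 2, so they can become
   atoms for [field]. *)
move: (D_ h H) (D'_ h H) D_neq0 (h `^ (2 * H)) p p_neq0 => D D' D0 q r r0.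
case: i => [[|[|[|]]]]//= hi; case: j => [[|[|[|[|]]]]]//= hj.
all: by field; rewrite ?D0 ?r0 ?h_neq0 ?gamma_neq0 ?ln2_neq0.
Qed.

End estimator_jacobian.

(** * Limits of the statistics of one subject *)

Section statistics_limits.
Context (R : realType) (d : measure_display) (T : measurableType d)
  (P : probability T R).
Implicit Types X Y : nat -> T -> R.

(** Identities between means may fail at n = 0, where the mean of a constant is 0. *)
Lemma eq_cvg_prob0 X Y : (forall n, measurable_fun setT (Y n)) ->
  (forall n w, (0 < n)%N -> X n w = Y n w) -> cvg_prob0 P X -> cvg_prob0 P Y.
Proof.
move=> mY XY [_ X0]; split => // e /X0; apply: cvg_trans.
apply: near_eq_cvg; exists 1%N => // n /= n0; congr (P _).
by apply/seteqP; split => w /=; rewrite XY.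
Qed.

Lemma cvg_prob0_sum (I : Type) (s : seq I) (X : I -> nat -> T -> R) :
  (forall i, cvg_prob0 P (X i)) ->
  cvg_prob0 P (fun n w => \sum_(i <- s) X i n w).
Proof.
move=> X0; elim: s => [|i s IH].
  have -> : (fun n w => \sum_(i <- [::]) X i n w) = (fun _ _ => 0).
    by apply/funext => n; apply/funext => w; rewrite big_nil.
  split => // e e0; have -> : (fun _ : nat => P [set w | e <= `|0 : R|]) = cst 0%E.
    apply/funext => n; rewrite (_ : [set _ | _] = set0) ?measure0//.
    by apply/seteqP; split => // w /=; rewrite normr0 leNgt e0.
  exact: cvg_cst.
have -> : (fun n w => \sum_(j <- i :: s) X j n w) =
    (fun n w => X i n w + \sum_(j <- s) X j n w).
  by apply/funext => n; apply/funext => w; rewrite big_cons.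
exact: cvg_prob0D.
Qed.

Lemma cvg_prob0B X Y : cvg_prob0 P X -> cvg_prob0 P Y ->
  cvg_prob0 P (fun n w => X n w - Y n w).
Proof.
move=> X0 Y0; have := cvg_prob0D X0 (cvg_prob0Z (-1) Y0).
by congr cvg_prob0; apply/funext => n; apply/funext => w; rewrite mulN1r.
Qed.

Variables (H h sigma gamma : R) (W G : R -> {RV P >-> R}) (theta : T -> R).
Hypothesis H_gt : 2^-1 < H.
Hypothesis H_lt : H < 1.
Hypothesis h_gt0 : 0 < h.
Hypothesis W_BM : standard_Brownian_motion P W.
Hypothesis G_fBM : fractional_Brownian_motion P H G.
Hypothesis WG_indep : independent2 P (sigma_process (fun t w => W t w))
  (sigma_process (fun t w => G t w)).
Hypothesis mtheta : measurable_fun setT theta.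

Let y (t : R) (w : T) : R := theta w * t + (sigma * W t w + gamma * G t w).

Let H_gt0 : 0 < H. Proof. by move: H_gt; lra. Qed.

Let my t : measurable_fun setT (y t).
Proof.
by do !apply: measurable_funD; apply: measurable_funM.
Qed.

Let mlag p k : measurable_fun setT (lag_increment h p y k).
Proof. exact: measurable_funB. Qed.

Let sqr_limit (p : nat) (w : T) : R := theta w ^+ 2 * (p%:R * h) ^+ 2 +
  sigma ^+ 2 * (p%:R * h) + gamma ^+ 2 * (p%:R * h) `^ (2 * H).

(** With t = p h, the square (theta t + sigma b + gamma g)^2 minus its limit is a combination of b,
    g, b^2 - t, g^2 - t^(2H) and b g, one weak law for each; the first two have theta in their
    coefficients. *)
Lemma lag_sqr_mean p s : (0 < p)%N -> cvg_prob0 P (fun n w =>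
  n%:R^-1 * \sum_(0 <= k < n) lag_increment h p y (k + s) w ^+ 2 - sqr_limit p w).
Proof.
move=> p0; have rho := noise_corr_cvg0 H_gt H_lt h_gt0 p0.
have b1 := BM_weak_law p W_BM h_gt0 s.
have b2 := BM_sqr_weak_law p W_BM h_gt0 s.
have g1 := fBM_weak_law G_fBM h_gt0 s rho.
have g2 := fBM_sqr_weak_law G_fBM h_gt0 H_gt0 s rho.
have bg := mixed_weak_law p W_BM h_gt0 G_fBM H_gt0 WG_indep s.
have {}b1 := cvg_prob0Z (2 * (p%:R * h) * sigma) (cvg_prob0Ml mtheta b1).
have {}g1 := cvg_prob0Z (2 * (p%:R * h) * gamma) (cvg_prob0Ml mtheta g1).
have {}b2 := cvg_prob0Z (sigma ^+ 2) b2.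
have {}g2 := cvg_prob0Z (gamma ^+ 2) g2.
have {}bg := cvg_prob0Z (2 * sigma * gamma) bg.
apply: eq_cvg_prob0 (cvg_prob0D (cvg_prob0D b1 g1) (cvg_prob0D (cvg_prob0D b2 g2) bg)).
  move=> n; apply: measurable_funB.
    apply: measurable_funM => //; apply: measurable_sum => k.
    exact: measurable_funX.
  apply: measurable_funD => //; apply: measurable_funD => //.
  by apply: measurable_funM => //; exact: measurable_funX.
move=> n w n0; have nR : n%:R != 0 :> R by rewrite pnatr_eq0 -lt0n.
have -> : sqr_limit p w = n%:R^-1 * \sum_(0 <= k < n) sqr_limit p w.
  by rewrite sumr_const_nat subn0 -[X in _ = _ * X]mulr_natl mulKf.
rewrite -mulrBr -sumrB; set Sy := \sum_(0 <= k < n) (_ - sqr_limit p w).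
have -> : Sy = (2 * (p%:R * h) * sigma * theta w *
      (\sum_(0 <= k < n) lag_increment h p (fun t w => W t w) (k + s) w) +
     2 * (p%:R * h) * gamma * theta w *
      (\sum_(0 <= k < n) lag_increment h p (fun t w => G t w) (k + s) w)) +
    (sigma ^+ 2 * (\sum_(0 <= k < n)
        (lag_increment h p (fun t w => W t w) (k + s) w ^+ 2 - p%:R * h)) +
     gamma ^+ 2 * (\sum_(0 <= k < n) (lag_increment h p (fun t w => G t w) (k + s) w ^+ 2
                   - (p%:R * h) `^ (2 * H))) +
     2 * sigma * gamma * (\sum_(0 <= k < n)
        (lag_increment h p (fun t w => W t w) (k + s) w *
         lag_increment h p (fun t w => G t w) (k + s) w))).
  rewrite !mulr_sumr -!big_split/=; apply: eq_bigr => k _.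
  by rewrite /lag_increment /y /sqr_limit natrD; ring.
by ring.
Qed.

Lemma theta_hat_mean :
  cvg_prob0 P (fun n w => theta_hat h n (y ^~ w) - theta w).
Proof.
have rho := noise_corr_cvg0 H_gt H_lt h_gt0 (ltn0Sn 0).
have b1 := cvg_prob0Z (sigma / h) (BM_weak_law 1 W_BM h_gt0 0).
have g1 := cvg_prob0Z (gamma / h) (fBM_weak_law G_fBM h_gt0 0 rho).
apply: eq_cvg_prob0 (cvg_prob0D b1 g1).
  move=> n; apply: measurable_funB => //; apply: measurable_funM => //.
  by apply: measurable_sum => k; exact: measurable_funB.
move=> n w n0; have nR : n%:R != 0 :> R by rewrite pnatr_eq0 -lt0n.
have hR : h != 0 by rewrite gt_eqF.
rewrite /theta_hat.
have -> : \sum_(0 <= k < n) increment h (y ^~ w) k =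
   n%:R * h * theta w +
   (sigma * \sum_(0 <= k < n) lag_increment h 1 (fun t w => W t w) (k + 0) w +
    gamma * \sum_(0 <= k < n) lag_increment h 1 (fun t w => G t w) (k + 0) w).
  have -> : n%:R * h * theta w = \sum_(0 <= k < n) h * theta w.
    by rewrite sumr_const_nat subn0 -mulrA mulr_natl.
  rewrite !mulr_sumr -!big_split/=; apply: eq_bigr => k _.
  by rewrite /increment /y /lag_increment addn0 addn1 -natr1; ring.
by field; rewrite hR nR.
Qed.

(** Written as 2 theta (x - theta) + (x - theta)^2, which again allows an arbitrary random theta. *)
Lemma theta_hat_sqr_mean :
  cvg_prob0 P (fun n w => theta_hat h n (y ^~ w) ^+ 2 - theta w ^+ 2).
Proof.
have t0 := theta_hat_mean.
have := cvg_prob0D (cvg_prob0Z 2 (cvg_prob0Ml mtheta t0)) (cvg_prob0M t0 t0).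
by congr cvg_prob0; apply/funext => n; apply/funext => w; ring.
Qed.

Lemma xi_stat_mean :
  cvg_prob0 P (fun n w => xi_stat h n (y ^~ w) - h ^+ 2 * theta_hat h n (y ^~ w) ^+ 2
    - (sigma ^+ 2 * h + gamma ^+ 2 * h `^ (2 * H))).
Proof.
have := cvg_prob0B (lag_sqr_mean 0 (ltn0Sn 0)) (cvg_prob0Z (h ^+ 2) theta_hat_sqr_mean).
congr cvg_prob0; apply/funext => n; apply/funext => w.
rewrite /xi_stat /sqr_limit mul1r.
under eq_bigr do rewrite addn0 /lag_increment addn1.
by rewrite /increment; ring.
Qed.

(** In the polarization the Brownian part of the limit, linear in the lag, cancels: 2h - h - h = 0.
    The quadratic drift leaves h^2 theta^2, removed by the squared drift estimate, and the
    fractional part leaves ((2h)^(2H) - 2 h^(2H)) / 2. *)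
Lemma eta_stat_mean :
  cvg_prob0 P (fun n w => eta_stat h n (y ^~ w) - h ^+ 2 * theta_hat h n (y ^~ w) ^+ 2
    - gamma ^+ 2 * h `^ (2 * H) * (2 `^ (2 * H - 1) - 1)).
Proof.
have := cvg_prob0B (cvg_prob0Z 2^-1 (cvg_prob0B (lag_sqr_mean 0 (ltn0Sn 1))
  (cvg_prob0D (lag_sqr_mean 0 (ltn0Sn 0)) (lag_sqr_mean 1 (ltn0Sn 0)))))
  (cvg_prob0Z (h ^+ 2) theta_hat_sqr_mean).
congr cvg_prob0; apply/funext => n; apply/funext => w.
have -> : eta_stat h n (y ^~ w) = 2^-1 *
  (n%:R^-1 * \sum_(0 <= k < n) lag_increment h 2 y (k + 0) w ^+ 2 -
   (n%:R^-1 * \sum_(0 <= k < n) lag_increment h 1 y (k + 0) w ^+ 2 +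
    n%:R^-1 * \sum_(0 <= k < n) lag_increment h 1 y (k + 1) w ^+ 2)).
  rewrite /eta_stat -mulrDr -mulrBr mulrCA; congr (_ * _).
  rewrite -big_split/= -sumrB mulr_sumr; apply: eq_bigr => k _.
  by rewrite /increment /lag_increment addn0 !addn1 addn2; field.
rewrite /sqr_limit mul1r powRM ?ltW// powR2_sub1.
(* As an atom, the inverse of n raises no side condition at n = 0. *)
by move: n%:R^-1 => ni; field.
Qed.

Lemma zeta_stat_mean :
  cvg_prob0 P (fun n w => zeta_stat h n (y ^~ w) - 4 * h ^+ 2 * theta_hat h n (y ^~ w) ^+ 2
    - gamma ^+ 2 * h `^ (2 * H) * 2 `^ (2 * H) * (2 `^ (2 * H - 1) - 1)).
Proof.
have := cvg_prob0B (cvg_prob0Z 2^-1 (cvg_prob0B (lag_sqr_mean 0 (ltn0Sn 3))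
  (cvg_prob0D (lag_sqr_mean 0 (ltn0Sn 1)) (lag_sqr_mean 2 (ltn0Sn 1)))))
  (cvg_prob0Z (4 * h ^+ 2) theta_hat_sqr_mean).
congr cvg_prob0; apply/funext => n; apply/funext => w.
have -> : zeta_stat h n (y ^~ w) = 2^-1 *
  (n%:R^-1 * \sum_(0 <= k < n) lag_increment h 4 y (k + 0) w ^+ 2 -
   (n%:R^-1 * \sum_(0 <= k < n) lag_increment h 2 y (k + 0) w ^+ 2 +
    n%:R^-1 * \sum_(0 <= k < n) lag_increment h 2 y (k + 2) w ^+ 2)).
  rewrite /zeta_stat -mulrDr -mulrBr mulrCA; congr (_ * _).
  rewrite -big_split/= -sumrB mulr_sumr; apply: eq_bigr => k _.
  by rewrite /lag_increment !addn0 addn4 !addn2; field.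
have powR4 : (4 : R) `^ (2 * H) = 2 `^ (2 * H) * 2 `^ (2 * H).
  by rewrite -powRM//; congr (_ `^ _); ring.
rewrite /sqr_limit !powRM ?ltW// powR4 powR2_sub1.
by move: n%:R^-1 => ni; field.
Qed.

End statistics_limits.

(** * Convergence in law to a Dirac mass *)

Section borel_vectors.
Context (R : realType) (d : measure_display) (T : measurableType d).

(* Open sets are countable unions of sup-norm balls with rational centers. *)
Lemma measurable_rV n (X : T -> 'rV[R]_n) :
  (forall j, measurable_fun setT (fun w => X w 0 j)) ->
  measurable_fun setT (X : T -> borel_rV R n).
Proof.
move=> mX; apply: (measurability _ (erefl (@measurable _ (borel_rV R n)))).
move=> _ [A oA <-]; rewrite setTI.
pose c (q : 'rV[rat]_n) : 'rV[R]_n := \row_j ratr (q 0 j).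
pose r (k : nat) : R := k.+1%:R^-1.
have r0 k : 0 < r k by rewrite invr_gt0 ltr0n.
pose F (i : 'rV[rat]_n * nat) : set T :=
  if `[< ball (c i.1) (r i.2) `<=` A >] then X @^-1` ball (c i.1) (r i.2) else set0.
have -> : X @^-1` A = \bigcup_i F i.
  apply/seteqP; split => [w Aw|w [i _]]; last first.
    by rewrite /F; case: asboolP => // iA; exact: iA.
  have /nbhs_ballP[e /= e0 eA] := open_nbhs_nbhs (conj oA Aw).
  (* A rational center within r k of X w has its ball of radius r k inside the ball of radius 2 r k
     <= e around X w, thus inside A. *)
  pose k := Num.truncn (2 / e).
  have ke : r k + r k <= e.
    have : r k <= e / 2.
      by rewrite /r -[leRHS]invf_div lef_pV2 ?posrE ?divr_gt0// ltW// truncnS_gt.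
    by lra.
  have /choice[q qX] : forall j : 'I_n, exists q : rat, `|X w 0 j - ratr q| < r k.
    move=> j; have : X w 0 j - r k < X w 0 j + r k by have := r0 k; lra.
    move=> /rat_in_itvoo[q]; rewrite in_itv/= => /andP[q1 q2].
    by exists q; rewrite ltr_norml; apply/andP; split; lra.
  exists (\row_j q j, k) => //; rewrite /F/= ifT; last first.
    apply/asboolP => y /= [_ cy]; apply: eA; split => // i j.
    rewrite ord1; apply: le_ball ke _ _; apply: ball_triangle (cy 0 j).
    by rewrite /c !mxE; exact: qX.
  split => // i j; rewrite ord1 /c !mxE; apply: ball_sym; exact: qX.
apply: countable_bigcupT_measurable => [|i]; first exact: countableP.
rewrite /F.
case: asboolP => // _.
have -> : X @^-1` ball (c i.1) (r i.2) =
    \bigcap_(j in [set: 'I_n]) [set w | `|X w 0 j - c i.1 0 j| < r i.2].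
  apply/seteqP; split => w /=.
    by move=> [_ Xw] j _ /=; rewrite distrC; exact: Xw.
  by move=> Xw; split => // k j; rewrite ord1 -ball_normE/= distrC; exact: Xw.
apply: fin_bigcap_measurable; first exact: finite_finset.
move=> j _.
have mf : measurable_fun setT (fun w => `|X w 0 j - c i.1 0 j|).
  by apply: measurableT_comp => //; exact: measurable_funB.
have := mf measurableT `]-oo, r i.2[%classic (measurable_itv _).
by rewrite setTI; congr measurable; apply/seteqP; split => w /=; rewrite in_itv.
Qed.

Lemma measurable_continuous_rV n (f : 'rV[R]_n -> R) : continuous f ->
  measurable_fun [set: borel_rV R n] (f : borel_rV R n -> R).
Proof.
move=> /continuousP cf; apply: (measurability _ (RGenOpens.measurableE R)).
move=> _ [_ [a [b ->] <-]]; rewrite setTI; apply: sub_sigma_algebra.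
exact/cf/interval_open.
Qed.

End borel_vectors.

Section convergence_in_law.
Context (R : realType) (d : measure_display) (T : measurableType d)
  (P : probability T R).

Local Notation E f := (\int[P]_w f w)%R.
Local Notation intg f := (P.-integrable setT (EFin \o f)).

(** Continuity is asked at c only, so the measurability of F along u has to be a separate
    hypothesis. The sum of the coordinate errors dominates the sup norm. *)
Lemma cvg_prob0_continuous n (F : 'rV[R]_n -> R) (c : 'rV[R]_n)
    (u : nat -> T -> 'rV[R]_n) :
  {for c, continuous F} -> (forall k, measurable_fun setT (fun w => F (u k w))) ->
  (forall j, cvg_prob0 P (fun k w => u k w 0 j - c 0 j)) ->
  cvg_prob0 P (fun k w => F (u k w) - F c).
Proof.
move=> cF mFu uc; split => [k|e e0]; first exact: measurable_funB.
have /cvgrPdist_lt/(_ e e0)/nbhs_ballP[dl /= dl0 dlF] := cF.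
have absj j : cvg_prob0 P (fun k w => `|u k w 0 j - c 0 j|).
  have [muj uj] := uc j; split => [k|a a0]; first exact: measurableT_comp.
  by under eq_fun do under eq_set do rewrite normr_id; exact: uj.
have [mS S0] := cvg_prob0_sum (enum 'I_n) absj.
apply: (squeeze_cvge0 _ (S0 dl dl0)) => k; rewrite measure_ge0/=.
apply: le_measure; rewrite ?inE.
- by apply: measurable_abs_ge; exact: measurable_funB.
- exact: measurable_abs_ge.
move=> w /=; apply: contraTT; rewrite -!ltNge => Sd.
have sum_ge0 (s : seq 'I_n) : 0 <= \sum_(j <- s) `|u k w 0 j - c 0 j|.
  by apply: sumr_ge0.
rewrite distrC; apply: dlF; split => // i j; rewrite ord1.
rewrite -ball_normE /= distrC (le_lt_trans _ Sd)// (ger0_norm (sum_ge0 _)).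
rewrite big_enum (bigD1 j)//= lerDl; exact: sumr_ge0.
Qed.

Lemma cvg_prob0_bounded (Y : nat -> T -> R) (M : R) : cvg_prob0 P Y ->
  (forall k w, `|Y k w| <= M) -> E (Y k) @[k --> \oo] --> (0 : R).
Proof.
move=> [mY Y0] YM.
have M0 : 0 <= M by exact: le_trans (YM 0%N point).
apply/cvgr0Pnorm_le => e e0.
have e20 : 0 < e / 2 by rewrite divr_gt0.
(* M + 1 because M may be 0; the mean is then at most e / 2 + M P(|Y| >= e / 2) <= e. *)
have eM : 0 < e / 2 / (M + 1) by rewrite divr_gt0//; lra.
have /ge0_cvge0P/(_ _ eM)[//|N _ YN] := Y0 _ e20.
exists N => // k Nk /=.
pose A := [set w | e / 2 <= `|Y k w|].
have mA : measurable A by exact: measurable_abs_ge.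
have iY : intg (Y k).
  apply: (@dominated_integrableT _ _ _ _ _ (fun=> M)) => //.
  exact: finite_measure_integrable_cst.
have i1 : intg (\1_A : T -> R) by exact: integrable_indic.
have iA := integrableT_D (finite_measure_integrable_cst P (e / 2) measurableT)
  (integrableT_Z M i1).
rewrite (le_trans (le_normr_Rintegral measurableT iY))//.
have inY : intg (fun w => `|Y k w|) by have := integrable_abse iY.
rewrite (le_trans (le_Rintegral measurableT inY iA _))//.
  move=> w _ /=; rewrite indicE; case: (boolP (w \in A)) => wA.
    by rewrite mulr1 (le_trans (YM k w))// lerDr ltW.
  by rewrite mulr0 addr0 ltW// ltNge; apply/negP => h; move/negP: wA; rewrite inE.
rewrite RintegralT_D//; last 2 first.
- exact: finite_measure_integrable_cst.
- exact: integrableT_Z.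
rewrite RintegralT_cst RintegralT_Z// {1}/Rintegral integral_indic// setIT.
have := YN _ Nk; rewrite -/A => PA.
have PAf : P A \is a fin_num by exact: fin_num_measure.
move: PA; rewrite -(fineK PAf) lee_fin ler_pdivlMr; last by lra.
have := fine_ge0 (measure_ge0 P A); lra.
Qed.

(** The convergence is asked for each test function separately, since f composed with the estimator
    is what gets rewritten in terms of translated averages. *)
Lemma cvg_in_law_dirac n (X : nat -> T -> 'rV[R]_n) (x : 'rV[R]_n) :
  (forall k j, measurable_fun setT (fun w => X k w 0 j)) ->
  (forall f : 'rV[R]_n -> R, continuous f ->
     (forall k, measurable_fun setT (fun w => f (X k w))) ->
     cvg_prob0 P (fun k w => f (X k w) - f x)) ->
  cvg_in_law P X (@dirac _ (borel_rV R n) x R).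
Proof.
move=> mX Xx; split => [k|f [cf [M fM]]]; first exact: measurable_rV.
have mf := measurable_continuous_rV cf.
have mfX k : measurable_fun setT (fun w => f (X k w)).
  by apply: (measurableT_comp mf); exact: measurable_rV.
have ifX k : intg (fun w => f (X k w)).
  apply: (@dominated_integrableT _ _ _ _ _ (fun=> M)) => //.
  exact: finite_measure_integrable_cst.
rewrite integral_dirac//; last exact/measurable_EFinP.
rewrite diracT mul1e.
have fX0 := cvg_prob0_bounded (Xx f cf mfX) (M := M + M).
have {}fX0 := fX0 (fun k w => le_trans (ler_normB _ _) (lerD (fM _) (fM _))).
have -> : (fun k => 'E_P[f \o X k])%E =
    (fun k => (E (fun w => f (X k w) - f x) + f x)%:E).
  apply/funext => k; rewrite RintegralB//; last exact: finite_measure_integrable_cst.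
  rewrite RintegralT_cst subrK unlock /Rintegral fineK//.
  exact: (integrable_fin_num measurableT (ifX k)).
apply: cvg_EFin; first by near=> k.
rewrite -[X in _ --> X]add0r; apply: (@cvgD _ R^o) => //; exact: cvg_cst.
Unshelve. all: by end_near. Qed.

End convergence_in_law.

(** * Degeneracy of the limit *)

Section estimator_invariance.
Context (R : realType).

(* The estimator only uses xi - h^2 V, eta - h^2 V and zeta - 4 h^2 V. *)
Lemma Theta_hat_shift (h c : R) (u : 'rV[R]_4) :
  Theta_hat h (u + c *: (H_vec h)^T) = Theta_hat h u.
Proof.
pose v := u + c *: (H_vec h)^T.
have Ea : v 0 1 - h ^+ 2 * v 0 0 = u 0 1 - h ^+ 2 * u 0 0 by rewrite !mxE /=; ring.
have Eb : v 0 2 - h ^+ 2 * v 0 0 = u 0 2 - h ^+ 2 * u 0 0 by rewrite !mxE /=; ring.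
have Ec : v 0 3 - 4 * h ^+ 2 * v 0 0 = u 0 3 - 4 * h ^+ 2 * u 0 0 by rewrite !mxE /=; ring.
by rewrite -/v /Theta_hat /sigma2_hat /gamma2_hat /H_hat Ea Eb Ec.
Qed.

(** The left side is the derivative along [H_vec], and by the shift invariance every difference
    quotient in that direction is 0. *)
Lemma jacobian_Theta_hat_H_vec (h : R) (u : 'rV[R]_4) :
  differentiable (Theta_hat h) u ->
  (jacobian (Theta_hat h) u)^T *m H_vec h = 0.
Proof.
move=> df; apply: trmx_inj; rewrite trmx_mul [X in _ *m X]trmxK trmx0 -deriveEjacobian//.
rewrite /derive (_ : (fun t => _) = cst 0) ?lim_cst//.
by apply/funext => t /=; rewrite [_ *: _ + u]addrC Theta_hat_shift subrr scaler0.
Qed.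

End estimator_invariance.

(** * Measurability of the estimator and of the averages *)

Section estimator_measurability.
Context (R : realType) (d : measure_display) (T : measurableType d).

(** Continuous off 0; the point 0, where the inverse is 0 by convention, is a measurable set of its
    own. *)
Lemma measurable_invr : measurable_fun [set: R] (fun x : R => x^-1).
Proof.
rewrite -(setvU [set 0 : R]); apply/measurable_funU => //.
  exact: measurableC.
split; last exact: measurable_fun_set1.
apply: open_continuous_measurable_fun.
  by apply: closed_openC; exact: closed_eq.
move=> x; rewrite inE /= => x0; apply: inv_continuous; exact/eqP.
Qed.

Lemma measurable_log2_plus : measurable_fun [set: R] (@log2_plus R).
Proof.
apply: measurable_fun_ifT => //; first exact: measurable_fun_ltr.
by apply: measurable_funM => //; exact: measurable_ln.
Qed.

Variables (h : R) (V xi eta zeta : T -> R).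
Hypothesis mV : measurable_fun setT V.
Hypothesis mxi : measurable_fun setT xi.
Hypothesis meta : measurable_fun setT eta.
Hypothesis mzeta : measurable_fun setT zeta.

Let measurable_ratio (f g : T -> R) : measurable_fun setT f ->
  measurable_fun setT g -> measurable_fun setT (fun w => f w / g w).
Proof.
move=> mf mg; apply: measurable_funM => //.
exact: (measurableT_comp measurable_invr).
Qed.

Let measurable_sub (c : R) (f : T -> R) : measurable_fun setT f ->
  measurable_fun setT (fun w => f w - c * V w).
Proof. by move=> mf; apply: measurable_funB => //; exact: measurable_funM. Qed.

Lemma measurable_H_hat :
  measurable_fun setT (fun w => H_hat h (V w) (xi w) (eta w) (zeta w)).
Proof.
apply: measurable_funM => //; apply: (measurableT_comp measurable_log2_plus).
by apply: measurable_ratio; exact: measurable_sub.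
Qed.

Let measurable_powH (a : R) :
  measurable_fun setT (fun w => a `^ (2 * H_hat h (V w) (xi w) (eta w) (zeta w))).
Proof.
apply: (measurableT_comp (measurable_powRr a)); apply: measurable_funM => //.
exact: measurable_H_hat.
Qed.

Lemma measurable_gamma2_hat :
  measurable_fun setT (fun w => gamma2_hat h (V w) (xi w) (eta w) (zeta w)).
Proof.
apply: measurable_ratio; first exact: measurable_sub.
apply: measurable_funM => //; apply: measurable_funB => //.
apply: (measurableT_comp (measurable_powRr 2)); apply: measurable_funB => //.
by apply: measurable_funM => //; exact: measurable_H_hat.
Qed.

Lemma measurable_sigma2_hat :
  measurable_fun setT (fun w => sigma2_hat h (V w) (xi w) (eta w) (zeta w)).
Proof.
apply: measurable_ratio => //; apply: measurable_funB; first exact: measurable_sub.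
by apply: measurable_funM => //; exact: measurable_gamma2_hat.
Qed.

End estimator_measurability.

Lemma measurable_Theta_hat (R : realType) (d : measure_display)
    (T : measurableType d) (h : R) (u : T -> 'rV[R]_4) :
  (forall j, measurable_fun setT (fun w => u w 0 j)) ->
  forall j, measurable_fun setT (fun w => Theta_hat h (u w) 0 j).
Proof.
move=> mu j; under eq_fun do rewrite mxE.
case: j => [[|[|[|]]]]//= _.
- exact: measurable_H_hat.
- exact: measurable_gamma2_hat.
- exact: measurable_sigma2_hat.
Qed.

Lemma measurable_U_bar (R : realType) (d : measure_display)
    (T : measurableType d) (h : R) n N (Y : nat -> R -> T -> R) :
  (forall i t, measurable_fun setT (Y i t)) ->
  forall j, measurable_fun setT (fun w => U_bar h n N (fun i t => Y i t w) 0 j).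
Proof.
move=> mY j.
have mavg (f : nat -> T -> R) : (forall i, measurable_fun setT (f i)) ->
    measurable_fun setT (fun w => average N (f ^~ w)).
  by move=> mf; apply: measurable_funM => //; exact: measurable_sum.
have minc i k : measurable_fun setT (fun w => increment h (fun t => Y i t w) k).
  exact: measurable_funB.
under eq_fun do rewrite mxE.
case: j => [[|[|[|[|]]]]]//= _; apply: mavg => i.
- apply: measurable_funX; apply: measurable_funM => //.
  exact: measurable_sum.
- apply: measurable_funM => //; apply: measurable_sum => k.
  exact: measurable_funX.
- apply: measurable_funM => //; apply: measurable_sum => k.
  exact: measurable_funM.
- apply: measurable_funM => //; apply: measurable_sum => k.
  by apply: measurable_funM => //; exact: measurable_funB.
Qed.

Theorem theorem1 (R : realType) (d : measure_display) (T : measurableType d)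
  (P : probability T R) (sigma gamma H h : R)
  (B BH : nat -> R -> {RV P >-> R}) (phi : nat -> {RV P >-> R})
  (sigma_gt0 : 0 < sigma) (gamma_gt0 : 0 < gamma) (h_gt0 : 0 < h)
  (H_gt : 2^-1 < H) (H_lt : H < 3 / 4)
  (B_BM : forall i, standard_Brownian_motion P (B i))
  (BH_fBM : forall i, fractional_Brownian_motion P H (BH i))
  (BBH_indep : mutually_independent P (fun x : nat + nat =>
     match x with
     | inl i => sigma_process (B i)
     | inr i => sigma_process (BH i)
     end))
  (phi_iid : iid P phi)
  (phi_M_indep : independent2 P
     (sigma_family [set: nat] phi)
     (sigma_family [set it : nat * R | 0 <= it.2]
        (fun it => mixed_fBm sigma gamma B BH it.1 it.2)))
  (phi_moment4 : forall i, ('E_P[(fun w => phi i w ^+ 4)%R] < +oo)%E) :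
  let V_infty := fine 'E_P[(fun w => theta sigma phi 0 w ^+ 2)%R] in
  let Binf := eta_infty h H gamma V_infty - h ^+ 2 * V_infty in
  let Uinf := U_infty h H sigma gamma V_infty in
  (* [jacobian] acts on row vectors, hence the transpose *)
  let J := (jacobian (Theta_hat h) Uinf)^T in
  let Sigma := fine 'V_P[(fun w => theta sigma phi 0 w ^+ 2)%R]
                 *: (H_vec h *m (H_vec h)^T) in
  let Theta := row_seq 3 [:: H; gamma ^+ 2; sigma ^+ 2] in
  [/\ differentiable (Theta_hat h) Uinf,
      Binf = gamma ^+ 2 * h `^ (2 * H) * (2 `^ (2 * H - 1) - 1),
      J = J_entries h H gamma Binf &
      exists nu : probability (borel_rV R 3) R,
        is_mvnormal nu 0 (J *m Sigma *m J^T) /\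
        sequential_cvg_in_law P
          (fun (n N : nat) (w : T) => Num.sqrt N%:R *:
             (Theta_hat h
                (U_bar h n N (fun i t => Y_process sigma gamma B BH phi i t w))
              - Theta)) nu].
Proof.
move=> V_infty Binf Uinf J Sigma Theta.
have H_lt1 : H < 1 by lra.
have diffU : differentiable (Theta_hat h) Uinf by exact: differentiable_Theta_hat.
have BinfE : Binf = gamma ^+ 2 * h `^ (2 * H) * (2 `^ (2 * H - 1) - 1).
  by rewrite /Binf /eta_infty; ring.
split => //; first by rewrite BinfE; exact: jacobian_Theta_hat.
have -> : J *m Sigma *m J^T = 0.
  by rewrite /Sigma -scalemxAr mulmxA jacobian_Theta_hat_H_vec// mul0mx scaler0 mul0mx.
pose nu : probability (borel_rV R 3) R := @dirac _ (borel_rV R 3) (0 : 'rV[R]_3) R.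
exists nu; split.
  move=> a; rewrite mul0mx mulmx0 mul0mx !mxE; split => // A mA.
  rewrite eqxx /nu /pushforward /= !diracE; congr ((nat_of_bool _)%:R%:E).
  by apply/idP/idP; rewrite !inE /preimage/= mul0mx mxE.
exists (fun=> nu); split; last by move=> f _; exact: cvg_cst.
move=> N N0.
pose th i := theta sigma (fun i => phi i) i.
pose y i t w := th i w * t + (sigma * B i t w + gamma * BH i t w).
have mth i : measurable_fun setT (th i) by exact: measurable_funB.
have my i t : measurable_fun setT (y i t).
  by do !apply: measurable_funD; apply: measurable_funM.
pose Ub n w := U_bar h n N (fun i t => y i t w).
have mUb n j : measurable_fun setT (fun w => Ub n w 0 j) by exact: measurable_U_bar.
pose X n w := Num.sqrt N%:R *: (Theta_hat h (Ub n w) - Theta).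
apply: (@cvg_in_law_dirac _ _ _ _ _ X).
  move=> n j; have -> : (fun w => X n w 0 j) =
      (fun w => Num.sqrt N%:R * (Theta_hat h (Ub n w) 0 j - Theta 0 j)).
    by apply/funext => w; rewrite !mxE.
  apply: measurable_funM => //; apply: measurable_funB => //.
  exact: measurable_Theta_hat (mUb n) j.
move=> f cf mfX.
(* The first coordinate is now exactly [V_infty], and each other one is a combination with constant
   limit plus the matching multiple of [V_infty]. *)
pose u n w := Ub n w + (V_infty - Ub n w 0 0) *: (H_vec h)^T.
pose F v := f (Num.sqrt N%:R *: (Theta_hat h v - Theta)).
have FU : F Uinf = f 0 by rewrite /F Theta_hat_U_infty// subrr scaler0.
have Fu n w : F (u n w) = f (X n w) by rewrite /F /u Theta_hat_shift.
have cF : {for Uinf, continuous F}.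
  apply: (@continuous_comp _ _ _
    (fun v => Num.sqrt N%:R *: (Theta_hat h v - Theta)) f); last exact: cf.
  apply: differentiable_continuous; apply: differentiableZ.
  exact: differentiableB.
have indep i : independent2 P (sigma_process (fun t w => B i t w))
    (sigma_process (fun t w => BH i t w)).
  exact: (mutually_independent_pair (i := inl i) (j := inr i) BBH_indep).
(* A finite sum of null sequences, as N is fixed. *)
have avg_cvg (c : R) (s : nat -> nat -> T -> R) :
    (forall i, cvg_prob0 P (fun n w => s i n w - c)) ->
    cvg_prob0 P (fun n w => average N (fun i => s i n w) - c).
  move=> sc; have := cvg_prob0Z N%:R^-1 (cvg_prob0_sum (index_iota 0 N) sc).
  congr cvg_prob0; apply/funext => n; apply/funext => w.
  rewrite sumrB sumr_const_nat subn0 mulrBr -[X in _ - _ * X]mulr_natl mulKf//.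
  by rewrite pnatr_eq0 -lt0n.
have avgB (a b : nat -> R) (c : R) :
    average N (fun i => a i - c * b i) = average N a - c * average N b.
  by rewrite /average sumrB -mulr_sumr mulrBr mulrCA.
have xi_cvg := avg_cvg _ _ (fun i => xi_stat_mean sigma gamma H_gt H_lt1 h_gt0
  (B_BM i) (BH_fBM i) (indep i) (mth i)).
have eta_cvg := avg_cvg _ _ (fun i => eta_stat_mean sigma gamma H_gt H_lt1 h_gt0
  (B_BM i) (BH_fBM i) (indep i) (mth i)).
have zeta_cvg := avg_cvg _ _ (fun i => zeta_stat_mean sigma gamma H_gt H_lt1 h_gt0
  (B_BM i) (BH_fBM i) (indep i) (mth i)).
have ucvg j : cvg_prob0 P (fun n w => u n w 0 j - Uinf 0 j).
  case: j => [[|[|[|[|]]]]]//= hj.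
  (* This difference is identically 0, obtained here as 0 times a null sequence. *)
  - have := cvg_prob0Z 0 xi_cvg; congr cvg_prob0.
    by apply/funext => n; apply/funext => w; rewrite !mxE /=; ring.
  - move: xi_cvg; congr cvg_prob0; apply/funext => n; apply/funext => w.
    by rewrite avgB !mxE /=; ring.
  - move: eta_cvg; congr cvg_prob0; apply/funext => n; apply/funext => w.
    by rewrite avgB !mxE /= /eta_infty; ring.
  - move: zeta_cvg; congr cvg_prob0; apply/funext => n; apply/funext => w.
    by rewrite avgB !mxE /=; ring.
have mF k : measurable_fun setT (fun w => F (u k w)).
  by have := mfX k; congr measurable_fun; apply/funext => w; rewrite Fu.
have := cvg_prob0_continuous cF mF ucvg.
by congr cvg_prob0; apply/funext => n; apply/funext => w; rewrite Fu FU.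
Qed.
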